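(* Let $K$ be an infinite field of characteristic different from $2$, and let $J$ be the Jordan algebra of the symmetric $2\times 2$ matrices over $K$ with product $uv:=\tfrac12(u\cdot v+v\cdot u)$ (where $\cdot$ is the matrix product), endowed with the $\mathbb{Z}_2$-grading $J=J_0\oplus J_1$, $J_0=\mathrm{span}(e_{11}+e_{22},\,e_{11}-e_{22})$, $J_1=\mathrm{span}(e_{12}+e_{21})$. Then the ideal $T=T_2(J)$ of all graded identities of $J$ is generated, as a graded T-ideal of the free graded Jordan algebra $J(X)$, by the polynomials (1) $x_1(x_2x_3)-x_2(x_1x_3)$, where $|x_1|=|x_2|$; (2) $(y_1y_2,z_1,z_2)-\bigl(y_1(y_2,z_1,z_2)+y_2(y_1,z_1,z_2)-2z_1(z_2,y_1,y_2)\bigr)$; (3) $(y_1y_2,y_3,z_1)-\bigl(y_1(y_2,y_3,z_1)+y_2(y_1,y_3,z_1)\bigr)$; (4) $(z_1z_2,x_1,x_2)$; (5) $(y_1,y_2,z_1,x,y_3)-(y_1,y_3,z_1,x,y_2)$.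
   Context: All algebras are unital over $K$. The $e_{ij}$ are the matrix units. $(a,b,c)=(ab)c-a(bc)$ is the associator; longer associators without inner parentheses are left normed: $(x_1,x_2,x_3,x_4,x_5)=((x_1,x_2,x_3),x_4,x_5)$, etc. $X=Y\cup Z$ is the disjoint union of the infinite sets $Y=\{y_1,y_2,\dots\}$ (even variables) and $Z=\{z_1,z_2,\dots\}$ (odd variables), and $J(X)$ is the free unital Jordan algebra over $K$ on $X$, graded by $\mathbb{Z}_2$: a monomial has $\mathbb{Z}_2$-degree $0$ if its total degree in the variables from $Z$ is even, and $1$ otherwise. $|u|$ denotes the $\mathbb{Z}_2$-degree of a homogeneous element $u$. The letter $y$ (with or without index) denotes an even variable, $z$ an odd variable, and $x$ an arbitrary variable (even or odd); thus each polynomial involving letters $x$ stands for all polynomials obtained by every choice of parities of the $x$'s allowed by the stated restriction. A polynomial $f(y_1,\dots,y_m,z_1,\dots,z_n)\in J(X)$ is a graded identity of a graded Jordan algebra $J=J_0\oplus J_1$ if it vanishes whenever the $y_i$ are replaced by any elements of $J_0$ and the $z_i$ by any elements of $J_1$; $T_2(J)$ is the set of all graded identities of $J$. A graded T-ideal is an ideal of $J(X)$ closed under all endomorphisms of $J(X)$ that respect the grading. *)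

(* Defs.v *)
From HB Require Import structures.
From mathcomp Require Import all_boot all_order all_algebra.
From mathcomp Require Import all_classical.

Set Implicit Arguments.
Unset Strict Implicit.
Unset Printing Implicit Defensive.

Import GRing.Theory.

Local Open Scope ring_scope.
Local Open Scope classical_set_scope.

Declare Scope jordan_scope.
Delimit Scope jordan_scope with J.

Reserved Notation "a ** b" (at level 40, left associativity).

HB.mixin Record Lmodule_isJordan (K : fieldType) V of GRing.Lmodule K V := {
  jone : V;
  jmul : V -> V -> V;
  jmulC : forall a b, jmul a b = jmul b a;
  jmulDl : forall a b c, jmul (a + b) c = jmul a c + jmul b c;
  jmulZl : forall (k : K) a b, jmul (k *: a) b = k *: jmul a b;
  jmul1l : forall a, jmul jone a = a;
  jordan_identity : forall a b,
    jmul (jmul (jmul a a) b) a = jmul (jmul a a) (jmul b a)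
}.

#[short(type="jordanType")]
HB.structure Definition Jordan (K : fieldType) :=
  { V of GRing.Lmodule K V & Lmodule_isJordan K V }.

Notation "a ** b" := (jmul a b) : jordan_scope.
Local Open Scope jordan_scope.

Definition jassoc (K : fieldType) (A : jordanType K) (a b c : A) : A :=
  (a ** b) ** c - a ** (b ** c).

(* The left normed (a, b, c, d, e) = ((a, b, c), d, e). *)
Definition jassoc5 (K : fieldType) (A : jordanType K) (a b c d e : A) : A :=
  jassoc (jassoc a b c) d e.

Record jordan_hom (K : fieldType) (A B : jordanType K) (phi : A -> B) : Prop := {
  jhomD : forall a b, phi (a + b) = phi a + phi b;
  jhomZ : forall (k : K) a, phi (k *: a) = k *: phi a;
  jhom1 : phi jone = jone;
  jhomM : forall a b, phi (a ** b) = phi a ** phi b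
}.

Record jordan_ideal (K : fieldType) (A : jordanType K) (I : set A) : Prop := {
  jideal0 : I 0;
  jidealD : forall a b, I a -> I b -> I (a + b);
  jidealZ : forall (k : K) a, I a -> I (k *: a);
  jidealM : forall a b, I a -> I (a ** b)
}.

Definition span_of (K : fieldType) (V : lmodType K) (S : set V) : set V :=
  [set v | exists n (c : 'I_n -> K) (s : 'I_n -> V),
     (forall i, S (s i)) /\ v = \sum_(i < n) c i *: s i].

(* The free unital Jordan algebra over K on X: formal expressions, modulo the
   least congruence containing the axioms of unital Jordan algebras. *)
Section FreeJordan.
Variables (K : fieldType) (X : Type).

Inductive jterm : Type :=
| TVar of X
| TZero
| TOne
| TAdd of jterm & jterm
| TOpp of jterm
| TScale of K & jterm
| TMul of jterm & jterm.

Inductive jeq : jterm -> jterm -> Prop :=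
| jeq_refl t : jeq t t
| jeq_sym t u : jeq t u -> jeq u t
| jeq_trans t u v : jeq t u -> jeq u v -> jeq t v
| jeq_add t t' u u' : jeq t t' -> jeq u u' -> jeq (TAdd t u) (TAdd t' u')
| jeq_opp t t' : jeq t t' -> jeq (TOpp t) (TOpp t')
| jeq_scale k t t' : jeq t t' -> jeq (TScale k t) (TScale k t')
| jeq_mul t t' u u' : jeq t t' -> jeq u u' -> jeq (TMul t u) (TMul t' u')
| jeq_addA t u v : jeq (TAdd t (TAdd u v)) (TAdd (TAdd t u) v)
| jeq_addC t u : jeq (TAdd t u) (TAdd u t)
| jeq_add0 t : jeq (TAdd TZero t) t
| jeq_addN t : jeq (TAdd (TOpp t) t) TZero
| jeq_scaleA k l t : jeq (TScale k (TScale l t)) (TScale (k * l) t)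
| jeq_scale1 t : jeq (TScale 1 t) t
| jeq_scaleDr k t u :
    jeq (TScale k (TAdd t u)) (TAdd (TScale k t) (TScale k u))
| jeq_scaleDl k l t :
    jeq (TScale (k + l) t) (TAdd (TScale k t) (TScale l t))
| jeq_mulC t u : jeq (TMul t u) (TMul u t)
| jeq_mulDl t u v : jeq (TMul (TAdd t u) v) (TAdd (TMul t v) (TMul u v))
| jeq_mulZl k t u : jeq (TMul (TScale k t) u) (TScale k (TMul t u))
| jeq_mul1 t : jeq (TMul TOne t) t
| jeq_jordan t u :
    jeq (TMul (TMul (TMul t t) u) t) (TMul (TMul t t) (TMul u t)).

HB.instance Definition _ := gen_eqMixin jterm.
HB.instance Definition _ := gen_choiceMixin jterm.

Definition jeqb : rel jterm := fun t u => `[< jeq t u >].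

Lemma jeqb_refl : reflexive jeqb.
Proof. by move=> t; apply/asboolP; exact: jeq_refl. Qed.

Lemma jeqb_sym : symmetric jeqb.
Proof. by move=> t u; apply/asboolP/asboolP; exact: jeq_sym. Qed.

Lemma jeqb_trans : transitive jeqb.
Proof.
by move=> u t v /asboolP tu /asboolP uv; apply/asboolP; exact: jeq_trans uv.
Qed.

Canonical jeqb_equiv := EquivRel jeqb jeqb_refl jeqb_sym jeqb_trans.

Definition freeJordan : Type := {eq_quot jeqb_equiv}%qT.

HB.instance Definition _ := Choice.on freeJordan.

Definition fjpi (t : jterm) : freeJordan := (\pi_({eq_quot jeqb_equiv}) t)%qT.
Definition fjrepr (a : freeJordan) : jterm :=
  repr (a : {eq_quot jeqb_equiv}%qT).

Lemma fjreprK a : fjpi (fjrepr a) = a.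
Proof. exact: reprK. Qed.

Lemma fjpiP t u : fjpi t = fjpi u <-> jeq t u.
Proof. by split=> [/eqmodP/asboolP//|tu]; apply/eqmodP/asboolP. Qed.

Lemma fjreprP t : jeq (fjrepr (fjpi t)) t.
Proof. by apply/fjpiP; rewrite fjreprK. Qed.

Definition fj_gen (x : X) : freeJordan := fjpi (TVar x).
Definition fj_zero : freeJordan := fjpi TZero.
Definition fj_one : freeJordan := fjpi TOne.
Definition fj_add (a b : freeJordan) : freeJordan :=
  fjpi (TAdd (fjrepr a) (fjrepr b)).
Definition fj_opp (a : freeJordan) : freeJordan := fjpi (TOpp (fjrepr a)).
Definition fj_scale (k : K) (a : freeJordan) : freeJordan :=
  fjpi (TScale k (fjrepr a)).
Definition fj_mul (a b : freeJordan) : freeJordan :=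
  fjpi (TMul (fjrepr a) (fjrepr b)).

Lemma fj_addE t u : fj_add (fjpi t) (fjpi u) = fjpi (TAdd t u).
Proof. by apply/fjpiP/jeq_add; exact: fjreprP. Qed.

Lemma fj_oppE t : fj_opp (fjpi t) = fjpi (TOpp t).
Proof. by apply/fjpiP/jeq_opp; exact: fjreprP. Qed.

Lemma fj_scaleE k t : fj_scale k (fjpi t) = fjpi (TScale k t).
Proof. by apply/fjpiP/jeq_scale; exact: fjreprP. Qed.

Lemma fj_mulE t u : fj_mul (fjpi t) (fjpi u) = fjpi (TMul t u).
Proof. by apply/fjpiP/jeq_mul; exact: fjreprP. Qed.

Lemma fjW (P : freeJordan -> Prop) : (forall t, P (fjpi t)) -> forall a, P a.
Proof. by move=> Pt a; rewrite -(fjreprK a). Qed.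

Let fjE := (fj_addE, fj_oppE, fj_scaleE, fj_mulE).

Fact fj_addA : associative fj_add.
Proof.
by elim/fjW=> t; elim/fjW=> u; elim/fjW=> v; rewrite !fjE; apply/fjpiP/jeq_addA.
Qed.

Fact fj_addC : commutative fj_add.
Proof.
by elim/fjW=> t; elim/fjW=> u; rewrite !fjE; apply/fjpiP/jeq_addC.
Qed.

Fact fj_add0 : left_id fj_zero fj_add.
Proof. by elim/fjW=> t; rewrite !fjE; apply/fjpiP/jeq_add0. Qed.

Fact fj_addN : left_inverse fj_zero fj_opp fj_add.
Proof. by elim/fjW=> t; rewrite !fjE; apply/fjpiP/jeq_addN. Qed.

HB.instance Definition _ :=
  GRing.isZmodule.Build freeJordan fj_addA fj_addC fj_add0 fj_addN.

Fact fj_scaleA k l a : fj_scale k (fj_scale l a) = fj_scale (k * l) a.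
Proof. by elim/fjW: a => t; rewrite !fjE; apply/fjpiP/jeq_scaleA. Qed.

Fact fj_scale1 : left_id 1 fj_scale.
Proof. by elim/fjW=> t; rewrite !fjE; apply/fjpiP/jeq_scale1. Qed.

Fact fj_scaleDr : right_distributive fj_scale +%R.
Proof.
move=> k; elim/fjW=> t; elim/fjW=> u; rewrite /GRing.add /= !fjE.
by apply/fjpiP/jeq_scaleDr.
Qed.

Fact fj_scaleDl a : {morph fj_scale^~ a : k l / k + l}.
Proof.
elim/fjW: a => t k l; rewrite [RHS]/GRing.add /= !fjE.
by apply/fjpiP/jeq_scaleDl.
Qed.

HB.instance Definition _ := GRing.Zmodule_isLmodule.Build K freeJordan
  fj_scaleA fj_scale1 fj_scaleDr fj_scaleDl.

Fact fj_mulC a b : fj_mul a b = fj_mul b a.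
Proof.
by elim/fjW: a => t; elim/fjW: b => u; rewrite !fjE; apply/fjpiP/jeq_mulC.
Qed.

Fact fj_mulDl a b c : fj_mul (a + b) c = fj_mul a c + fj_mul b c.
Proof.
elim/fjW: a => t; elim/fjW: b => u; elim/fjW: c => v.
by rewrite /GRing.add /= !fjE; apply/fjpiP/jeq_mulDl.
Qed.

Fact fj_mulZl (k : K) (a b : freeJordan) :
  fj_mul (k *: a) b = k *: fj_mul a b.
Proof.
elim/fjW: a => t; elim/fjW: b => u.
by rewrite /GRing.scale /= !fjE; apply/fjpiP/jeq_mulZl.
Qed.

Fact fj_mul1l a : fj_mul fj_one a = a.
Proof. by elim/fjW: a => t; rewrite !fjE; apply/fjpiP/jeq_mul1. Qed.

Fact fj_jordan a b :
  fj_mul (fj_mul (fj_mul a a) b) a = fj_mul (fj_mul a a) (fj_mul b a).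
Proof.
by elim/fjW: a => t; elim/fjW: b => u; rewrite !fjE; apply/fjpiP/jeq_jordan.
Qed.

HB.instance Definition _ := Lmodule_isJordan.Build K freeJordan
  fj_mulC fj_mulDl fj_mulZl fj_mul1l fj_jordan.

Section Evaluation.
Variables (A : jordanType K) (s : X -> A).

Fixpoint jterm_eval (t : jterm) : A :=
  match t with
  | TVar x => s x
  | TZero => 0
  | TOne => jone
  | TAdd t u => jterm_eval t + jterm_eval u
  | TOpp t => - jterm_eval t
  | TScale k t => k *: jterm_eval t
  | TMul t u => jterm_eval t ** jterm_eval u
  end.

Definition fj_eval (f : freeJordan) : A := jterm_eval (fjrepr f).

Lemma jterm_eval_eq t u : jeq t u -> jterm_eval t = jterm_eval u.
Proof.
elim=> //=.
- by move=> ? ? ? _ -> _ ->.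
- by move=> ? ? ? ? _ -> _ ->.
- by move=> ? ? _ ->.
- by move=> ? ? ? _ ->.
- by move=> ? ? ? ? _ -> _ ->.
- by move=> *; exact: addrA.
- by move=> *; exact: addrC.
- by move=> *; exact: add0r.
- by move=> *; exact: addNr.
- by move=> *; exact: scalerA.
- by move=> *; exact: scale1r.
- by move=> *; exact: scalerDr.
- by move=> *; exact: scalerDl.
- by move=> *; exact: jmulC.
- by move=> *; exact: jmulDl.
- by move=> *; exact: jmulZl.
- by move=> *; exact: jmul1l.
- by move=> *; exact: jordan_identity.
Qed.

Lemma fj_evalE t : fj_eval (fjpi t) = jterm_eval t.
Proof. exact/jterm_eval_eq/fjreprP. Qed.

Lemma fj_eval_hom : jordan_hom fj_eval.
Proof.
split=> [a b|k a||a b].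
- by elim/fjW: a => t; elim/fjW: b => u; rewrite [in LHS]/GRing.add /= fjE !fj_evalE.
- by elim/fjW: a => t; rewrite [in LHS]/GRing.scale /= fjE !fj_evalE.
- by rewrite /jone /= fj_evalE.
- by elim/fjW: a => t; elim/fjW: b => u; rewrite [in LHS]/jmul /= fjE !fj_evalE.
Qed.

Lemma fj_eval_gen x : fj_eval (fj_gen x) = s x.
Proof. exact: fj_evalE. Qed.

Lemma fj_eval_unique (phi : freeJordan -> A) :
  jordan_hom phi -> (forall x, phi (fj_gen x) = s x) -> phi =1 fj_eval.
Proof.
move=> [pD pZ p1 pM] px; elim/fjW=> t; rewrite fj_evalE.
have p0 : phi 0 = 0 by rewrite -(scale0r 0) pZ scale0r.
have pN a : phi (- a) = - phi a by rewrite -scaleN1r pZ scaleN1r.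
elim: t => //= [t <- u <-|t <-|k t <-|t <- u <-].
- by rewrite -pD [in RHS]/GRing.add /= fjE.
- by rewrite -pN [in RHS]/GRing.opp /= fjE.
- by rewrite -pZ [in RHS]/GRing.scale /= fjE.
- by rewrite -pM [in RHS]/jmul /= fjE.
Qed.

End Evaluation.

End FreeJordan.

(* Variables: [Yvar i] is y_i (even) and [Zvar i] is z_i (odd); a degree in
   Z_2 is a boolean, [true] being the degree 1. *)
Inductive gvar : Type := Yvar of nat | Zvar of nat.

Definition var_deg (x : gvar) : bool := if x is Zvar _ then true else false.

Definition xvar (p : bool) (i : nat) : gvar := if p then Zvar i else Yvar i.

Notation JX K := (freeJordan K gvar).

Inductive monomial : Type :=
| MOne
| MVar of gvar
| MMul of monomial & monomial.

Fixpoint zdegree (m : monomial) : nat :=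
  match m with
  | MOne => 0
  | MVar x => var_deg x
  | MMul m1 m2 => (zdegree m1 + zdegree m2)%N
  end.

Fixpoint jmono (K : fieldType) (m : monomial) : JX K :=
  match m with
  | MOne => jone
  | MVar x => fj_gen K x
  | MMul m1 m2 => jmono K m1 ** jmono K m2
  end.

Definition JX_gr (K : fieldType) (p : bool) : set (JX K) :=
  span_of [set f | exists2 m, odd (zdegree m) = p & f = jmono K m].

Definition graded_identities (K : fieldType) (A : jordanType K)
    (gr : bool -> set A) : set (JX K) :=
  [set f | forall s : gvar -> A,
     (forall x, gr (var_deg x) (s x)) -> fj_eval s f = 0].

Definition graded_endo (K : fieldType) (phi : JX K -> JX K) : Prop :=
  jordan_hom phi /\ forall p f, JX_gr p f -> JX_gr p (phi f).

Definition graded_Tideal (K : fieldType) (I : set (JX K)) : Prop :=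
  jordan_ideal I /\
  forall phi : JX K -> JX K, graded_endo phi -> forall f, I f -> I (phi f).

Definition graded_Tideal_gen (K : fieldType) (S : set (JX K)) : set (JX K) :=
  \bigcap_(I in [set I | graded_Tideal I /\ S `<=` I]) I.

Section Sym2.
Variable K : fieldType.

Definition sym2_pred : {pred 'M[K]_2} := fun u => u^T == u.

Fact sym2_submod_closed : submod_closed sym2_pred.
Proof.
split=> [|k u v]; rewrite !unfold_in /= ?trmx0 // linearP /=.
by move=> /eqP -> /eqP ->.
Qed.

HB.instance Definition _ :=
  GRing.isSubmodClosed.Build K 'M[K]_2 sym2_pred sym2_submod_closed.

(* The unit law of the product (u.v + v.u)/2 needs char K <> 2, so the type
   carries a proof of that as a phantom parameter. *)
Record sym2 (K2 : 2%N \notin [pchar K]) : Type :=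
  Sym2 { sym2_val :> 'M[K]_2; _ : sym2_val \in sym2_pred }.

Section Structure.
Variable K2 : 2%N \notin [pchar K].
Local Notation S := (sym2 K2).

HB.instance Definition _ := [isSub for @sym2_val K2].
HB.instance Definition _ := [Choice of S by <:].
HB.instance Definition _ := [SubChoice_isSubZmodule of S by <:].
HB.instance Definition _ := [SubZmodule_isSubLmodule of S by <:].

Fact sym2_two_neq0 : 2%:R != 0 :> K.
Proof. by move: K2; rewrite inE /=. Qed.

Definition mxjordan (u v : 'M[K]_2) : 'M[K]_2 := 2%:R^-1 *: (u *m v + v *m u).

Fact mxjordan_sym (u v : S) : mxjordan (val u) (val v) \in sym2_pred.
Proof.
have := valP u; have := valP v; rewrite !unfold_in => /eqP vT /eqP uT.
by rewrite linearZ linearD /= !trmx_mul uT vT addrC.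
Qed.

Fact sym2_one_sym : (1%:M : 'M[K]_2) \in sym2_pred.
Proof. by rewrite unfold_in trmx1. Qed.

Definition sym2_one : S := Sym2 K2 sym2_one_sym.
Definition sym2_mul (u v : S) : S := Sym2 K2 (mxjordan_sym u v).

Fact sym2_mulC u v : sym2_mul u v = sym2_mul v u.
Proof. by apply: val_inj; rewrite /= /mxjordan addrC. Qed.

Fact sym2_mulDl u v w : sym2_mul (u + v) w = sym2_mul u w + sym2_mul v w.
Proof.
apply: val_inj; rewrite /= /mxjordan -scalerDr mulmxDl mulmxDr.
by rewrite addrACA.
Qed.

Fact sym2_mulZl (k : K) u v : sym2_mul (k *: u) v = k *: sym2_mul u v.
Proof.
apply: val_inj; rewrite /= /mxjordan -scalemxAl -scalemxAr -scalerDr.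
by rewrite !scalerA mulrC.
Qed.

Fact sym2_mul1l u : sym2_mul sym2_one u = u.
Proof.
apply: val_inj; rewrite /= /mxjordan mul1mx mulmx1 -mulr2n -scaler_nat scalerA.
by rewrite mulVf ?sym2_two_neq0 // scale1r.
Qed.

Fact sym2_jordan u v :
  sym2_mul (sym2_mul (sym2_mul u u) v) u =
  sym2_mul (sym2_mul u u) (sym2_mul v u).
Proof.
apply: val_inj; rewrite /= /mxjordan; move: (sym2_val u) (sym2_val v) => a b.
set k := 2%:R^-1; rewrite -!(scalemxAl, scalemxAr) -!scalerDr -!scalemxAr.
rewrite -!scalemxAl -!scalerDr -?(scalemxAl, scalemxAr) !scalerA.
congr (_ *: _); set c := a *m a + a *m a.
have ac : a *m c = c *m a by rewrite /c mulmxDl mulmxDr mulmxA.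
clearbody c; rewrite !mulmxDl !mulmxDr !mulmxA ac -[b *m c *m a]mulmxA -ac mulmxA.
by rewrite -!addrA; congr (_ + _); rewrite addrCA.
Qed.

HB.instance Definition _ := Lmodule_isJordan.Build K S
  sym2_mulC sym2_mulDl sym2_mulZl sym2_mul1l sym2_jordan.

Definition sym2_gr (p : bool) : set S :=
  let e i j : 'M[K]_2 := delta_mx i j in
  [set u | span_of (if p then [set e 0 1 + e 1 0]
                    else [set e 0 0 + e 1 1; e 0 0 - e 1 1]) (sym2_val u)].

End Structure.
End Sym2.

(* Main.v *)
Require Import Defs.
From HB Require Import structures.
From mathcomp Require Import all_boot all_order all_algebra.
From mathcomp Require Import finmap all_classical.
From mathcomp Require Import ring.

Set Implicit Arguments.
Unset Strict Implicit.
Unset Printing Implicit Defensive.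

Import GRing.Theory.

Local Open Scope ring_scope.
Local Open Scope classical_set_scope.
Local Open Scope jordan_scope.

(** Write the algebra as K1 + Ke + Kw with e = e11 - e22 and w = e12 + e21, so
    that e^2 = w^2 = 1 and ew = 0.  A generic even element is a + be, a generic
    odd one is cw.  Hence, for even u, v and odd m, n, with b_u the coefficient
    of e in u,
      - left multiplication by u acts on the odd part as the scalar a;
      - (u, v, m) is b_u b_v m;
      - u (m n) - (u m) n is b_u e (m n)   (written [eterm u m n] below).
    These expressions make sense in any graded Jordan algebra, and the five
    families of identities (the fields of [basis_identities]) say that they
    obey the calculus that their values suggest: b is a derivation-like function
    of u ([bid_deriv_zz], [bid_deriv_yz]), products of b's are symmetric in
    their factors ([bid_swap]), a product of two odd elements is central
    ([bid_zz_nucleus]), and odd factors, or multiplications by even elements,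
    can be exchanged ([bid_lcomm]).

    So let I be the graded T-ideal that they generate and Q = J(X)/I.  With
    letters y_i and z_i, Q is spanned by
      - the words in the y's,
      - [odd_nf al be ga], whose value in the matrix algebra is the monomial
        a^al b^be c^ga times w, for be even and ga odd,
      - [even_nf al be ga], whose value is a^al b^be c^ga times 1 or e, for ga
        even and nonempty,
    and each of these depends on the three words up to permutation only.  The
    spanning ([normal_form_span]) holds because the span of these elements is
    closed under products.

    If f is a graded identity of the matrix algebra, write f modulo I as a
    combination of normal forms.  As I consists of graded identities, this
    combination vanishes at the generic point.  Over an infinite field distinct
    monomials are linearly independent functions ([vanishing_sum]), so the
    coefficients of equal normal forms add up to zero, and f lies in I. *)

(** * Bilinearity, homomorphisms and linear spans *)
Section Bilinear.
Variables (K : fieldType) (A : jordanType K).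
Implicit Types a b c : A.

Lemma jmulDr a b c : a ** (b + c) = a ** b + a ** c.
Proof. by rewrite jmulC jmulDl !(jmulC a). Qed.

Lemma jmulZr k a b : a ** (k *: b) = k *: (a ** b).
Proof. by rewrite jmulC jmulZl jmulC. Qed.

Lemma jmulNl a b : (- a) ** b = - (a ** b).
Proof. by rewrite -(scaleN1r a) jmulZl scaleN1r. Qed.

Lemma jmulNr a b : a ** (- b) = - (a ** b).
Proof. by rewrite jmulC jmulNl jmulC. Qed.

Lemma jmulBl a b c : (a - b) ** c = a ** c - b ** c.
Proof. by rewrite jmulDl jmulNl. Qed.

Lemma jmulBr a b c : a ** (b - c) = a ** b - a ** c.
Proof. by rewrite jmulDr jmulNr. Qed.

Lemma jmul0l a : 0 ** a = 0.
Proof. by rewrite -(scale0r (0 : A)) jmulZl !scale0r. Qed.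

Lemma jmul0r a : a ** 0 = 0.
Proof. by rewrite jmulC jmul0l. Qed.

Lemma jmul1r a : a ** jone = a.
Proof. by rewrite jmulC jmul1l. Qed.

End Bilinear.

Section Homs.
Variables (K : fieldType) (A B : jordanType K) (phi : A -> B).
Hypothesis hphi : jordan_hom phi.

Lemma jhom0 : phi 0 = 0.
Proof. by rewrite -(scale0r (0 : A)) (jhomZ hphi) !scale0r. Qed.

Lemma jhomN a : phi (- a) = - phi a.
Proof. by rewrite -scaleN1r (jhomZ hphi) scaleN1r. Qed.

Lemma jhomB a b : phi (a - b) = phi a - phi b.
Proof. by rewrite (jhomD hphi) jhomN. Qed.

Lemma jhom_sum I (r : seq I) (F : I -> A) :
  phi (\sum_(i <- r) F i) = \sum_(i <- r) phi (F i).
Proof. by apply: big_morph; [exact: (jhomD hphi) | exact: jhom0]. Qed.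

Lemma jhom_jassoc a b c : phi (jassoc a b c) = jassoc (phi a) (phi b) (phi c).
Proof. by rewrite /jassoc jhomB !(jhomM hphi). Qed.

End Homs.

Lemma jordan_hom_comp (K : fieldType) (A B C : jordanType K)
    (f : A -> B) (g : B -> C) :
  jordan_hom f -> jordan_hom g -> jordan_hom (g \o f).
Proof.
move=> [fD fZ f1 fM] [gD gZ g1 gM]; split=> *;
  by rewrite /= ?fD ?fZ ?f1 ?fM ?gD ?gZ ?g1 ?gM.
Qed.

Section Span.
Variables (K : fieldType) (V : lmodType K).
Implicit Types S : set V.

Lemma span_of_gen S x : S x -> span_of S x.
Proof.
move=> Sx; exists 1%N, (fun=> 1), (fun=> x); split=> //.
by rewrite big_ord1 scale1r.
Qed.

Lemma span_of0 S : span_of S 0.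
Proof.
by exists 0%N, (fun=> 0), (fun=> 0); split=> [[] | ]; rewrite ?big_ord0.
Qed.

Lemma span_ofZ S k x : span_of S x -> span_of S (k *: x).
Proof.
move=> [n [c [s [Ss ->]]]]; exists n, (fun i => k * c i), s; split=> //.
by rewrite scaler_sumr; apply: eq_bigr => i _; rewrite scalerA.
Qed.

Lemma span_ofD S x y : span_of S x -> span_of S y -> span_of S (x + y).
Proof.
move=> [n [c [s [Ss ->]]]] [n' [c' [s' [Ss' ->]]]].
exists (n + n')%N,
  (fun i : 'I_(n + n') =>
     match fintype.split i with inl j => c j | inr j => c' j end),
  (fun i : 'I_(n + n') =>
     match fintype.split i with inl j => s j | inr j => s' j end); split.
  by move=> i; case: (fintype.split i).
rewrite big_split_ord /=; congr (_ + _); apply: eq_bigr => i _.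
  by rewrite (unsplitK (inl _ i)).
by rewrite (unsplitK (inr _ i)).
Qed.

Lemma span_ofB S x y : span_of S x -> span_of S y -> span_of S (x - y).
Proof.
by move=> Sx Sy; apply: span_ofD => //; rewrite -scaleN1r; apply: span_ofZ.
Qed.

Lemma span_of_ind S (P : V -> Prop) :
  P 0 -> (forall x y, P x -> P y -> P (x + y)) ->
  (forall k x, P x -> P (k *: x)) -> (forall x, S x -> P x) ->
  forall x, span_of S x -> P x.
Proof.
move=> P0 PD PZ PS x [n [c [s [Ss ->]]]].
by elim/big_ind: _ => // i _; apply/PZ/PS.
Qed.

End Span.

Lemma span_of_param (K : fieldType) (V : lmodType K) (T : Type) (D : T -> Prop)
    (N : T -> V) (S : set V) v :
  span_of S v -> (forall x, S x -> exists t, D t /\ x = N t) ->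
  exists n (c : 'I_n -> K) (t : 'I_n -> T),
    (forall i, D (t i)) /\ v = \sum_(i < n) c i *: N (t i).
Proof.
move=> [n [c [s [Ss ->]]]] SD; have [t Dt] := choice (fun i => SD _ (Ss i)).
exists n, c, t; split=> [i|]; first exact: (Dt i).1.
by apply: eq_bigr => i _; rewrite -(Dt i).2.
Qed.

Lemma span_of_setU (K : fieldType) (V : lmodType K) (S T : set V) v :
  span_of (S `|` T) v -> exists u u', [/\ span_of S u, span_of T u' & v = u + u'].
Proof.
elim/span_of_ind: v / => [|_ _ [a [a' [Sa Ta' ->]]] [b [b' [Sb Tb' ->]]]
  |k _ [a [a' [Sa Ta' ->]]]|v [Sv|Tv]].
- by exists 0, 0; rewrite addr0; split=> //; apply: span_of0.
- by exists (a + b), (a' + b'); rewrite addrACA; split=> //; apply: span_ofD.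
- by exists (k *: a), (k *: a'); rewrite scalerDr; split=> //; apply: span_ofZ.
- by exists v, 0; rewrite addr0; split=> //; [apply: span_of_gen | apply: span_of0].
- by exists 0, v; rewrite add0r; split=> //; [apply: span_of0 | apply: span_of_gen].
Qed.

Lemma span_of_map (K : fieldType) (V W : lmodType K) (S : set V) (U : set W)
    (f : V -> W) :
  (forall a b, f (a + b) = f a + f b) ->
  (forall (x : K) a, f (x *: a) = x *: f a) ->
  (forall a, S a -> span_of U (f a)) -> forall a, span_of S a -> span_of U (f a).
Proof.
move=> fD fZ fS a; elim/span_of_ind: a / => [|a b Ha Hb|x a Ha|//].
- by rewrite -(scale0r (0 : V)) fZ scale0r; apply: span_of0.
- by rewrite fD; apply: span_ofD.
- by rewrite fZ; apply: span_ofZ.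
Qed.

Lemma span_of_mul (K : fieldType) (A : jordanType K) (S T U : set A) :
  (forall a b, S a -> T b -> span_of U (a ** b)) ->
  forall a b, span_of S a -> span_of T b -> span_of U (a ** b).
Proof.
move=> STU a b Sa; elim/span_of_ind: b /.
- by rewrite jmul0r; apply: span_of0.
- by move=> b b' Ub Ub'; rewrite jmulDr; apply: span_ofD.
- by move=> k b Ub; rewrite jmulZr; apply: span_ofZ.
move=> b Tb; elim/span_of_ind: a / Sa.
- by rewrite jmul0l; apply: span_of0.
- by move=> a a' Ua Ua'; rewrite jmulDl; apply: span_ofD.
- by move=> k a Ua; rewrite jmulZl; apply: span_ofZ.
by move=> a Sa; apply: STU.
Qed.

(** * Graded Jordan algebras and their ideals of graded identities *)
Record jordan_grading (K : fieldType) (A : jordanType K)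
    (gr : bool -> set A) : Prop := {
  jgr0 : forall p, gr p 0;
  jgrD : forall p a b, gr p a -> gr p b -> gr p (a + b);
  jgrZ : forall p (k : K) a, gr p a -> gr p (k *: a);
  jgr1 : gr false jone;
  jgrM : forall p q a b, gr p a -> gr q b -> gr (p (+) q) (a ** b)
}.

Lemma JX_grading (K : fieldType) : jordan_grading (@JX_gr K).
Proof.
split=> [p|p a b|p k a||p q].
- exact: span_of0.
- exact: span_ofD.
- exact: span_ofZ.
- by apply: span_of_gen; exists MOne.
apply: span_of_mul => a b [m mp ->] [m' mq ->].
by apply: span_of_gen; exists (MMul m m'); rewrite //= oddD mp mq.
Qed.

Lemma JX_gr_gen (K : fieldType) (x : gvar) : JX_gr (var_deg x) (fj_gen K x).
Proof. by apply: span_of_gen; exists (MVar x) => //=; rewrite oddb. Qed.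

Section Evaluation.
Variables (K : fieldType) (A : jordanType K) (gr : bool -> set A).
Hypothesis grA : jordan_grading gr.
Variable s : gvar -> A.
Hypothesis grs : forall x, gr (var_deg x) (s x).

Lemma fj_eval_graded p f : JX_gr p f -> gr p (fj_eval s f).
Proof.
have hs := fj_eval_hom s.
elim/span_of_ind: f /.
- by rewrite (jhom0 hs); apply: (jgr0 grA).
- by move=> f g; rewrite (jhomD hs); apply: (jgrD grA).
- by move=> k f; rewrite (jhomZ hs); apply: (jgrZ grA).
move=> _ [m <- ->]; elim: m => [|x|m IHm m' IHm'] /=.
- by rewrite (jhom1 hs); apply: (jgr1 grA).
- by rewrite fj_eval_gen oddb.
- by rewrite (jhomM hs) oddD; apply: (jgrM grA).
Qed.

End Evaluation.

Lemma fj_eval_endo (K : fieldType) (s : gvar -> JX K) :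
  (forall x, JX_gr (var_deg x) (s x)) -> graded_endo (fj_eval s).
Proof.
by move=> grs; split; [exact: fj_eval_hom | exact: (fj_eval_graded (JX_grading K))].
Qed.

(** Naturality of evaluation: both sides are homomorphisms that agree on the
    generators. *)
Lemma fj_eval_comp (K : fieldType) (A B : jordanType K) (phi : A -> B)
    (s : gvar -> A) f :
  jordan_hom phi -> phi (fj_eval s f) = fj_eval (phi \o s) f.
Proof.
move=> hphi.
have hc := jordan_hom_comp (fj_eval_hom s) hphi.
rewrite -[LHS]/((phi \o fj_eval s) f).
by apply: (fj_eval_unique hc) => x /=; rewrite fj_eval_gen.
Qed.

Lemma graded_identities_Tideal (K : fieldType) (A : jordanType K)
    (gr : bool -> set A) :
  jordan_grading gr -> graded_Tideal (graded_identities gr).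
Proof.
move=> grA; split.
  split=> [s _|f g Tf Tg s grs|k f Tf s grs|f g Tf s grs];
    have hs := fj_eval_hom s.
  - exact: (jhom0 hs).
  - by rewrite (jhomD hs) Tf // Tg // addr0.
  - by rewrite (jhomZ hs) Tf // scaler0.
  - by rewrite (jhomM hs) Tf // jmul0l.
move=> phi [hphi gphi] f Tf s grs.
have hc := jordan_hom_comp hphi (fj_eval_hom s).
rewrite -[LHS]/((fj_eval s \o phi) f).
rewrite (fj_eval_unique hc (s := fun x => fj_eval s (phi (fj_gen K x)))) //.
by apply: Tf => x; apply/(fj_eval_graded grA grs)/gphi/JX_gr_gen.
Qed.

(** * Quotient of a Jordan algebra by an ideal *)
Section QuotientByIdeal.
Variables (K : fieldType) (A : jordanType K) (I : set A).
Hypothesis idI : jordan_ideal I.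

(** The proof that I is an ideal is an argument of the predicate, so that the
    closure properties can be attached to it as canonical instances. *)
Definition ideal_mem of jordan_ideal I : {pred A} := fun a => `[< I a >].

Fact ideal_mem_zmod : zmod_closed (ideal_mem idI).
Proof.
split=> [|a b]; first by apply/asboolP; apply: (jideal0 idI).
move=> /asboolP Ia /asboolP Ib; apply/asboolP/(jidealD idI) => //.
by rewrite -scaleN1r; apply: (jidealZ idI).
Qed.

HB.instance Definition _ :=
  GRing.isZmodClosed.Build A (ideal_mem idI) ideal_mem_zmod.

Definition jquot : Type := (Quotient.quot (ideal_mem idI)).
HB.instance Definition _ := GRing.Zmodule.on jquot.

Definition jpi (a : A) : jquot := (\pi_(Quotient.quot (ideal_mem idI)) a)%qT.
Definition jrepr (x : jquot) : A := repr (x : (Quotient.quot (ideal_mem idI))).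

Lemma jreprK x : jpi (jrepr x) = x. Proof. exact: reprK. Qed.

Lemma jpi_eq a b : jpi a = jpi b <-> I (a - b).
Proof.
split=> [/eqP|Iab].
  by rewrite /jpi -Quotient.idealrBE => /asboolP.
by apply/eqP; rewrite /jpi -Quotient.idealrBE; apply/asboolP.
Qed.

Lemma jpiD a b : jpi (a + b) = jpi a + jpi b.
Proof. exact: raddfD. Qed.

Lemma jpiW (P : jquot -> Prop) : (forall a, P (jpi a)) -> forall x, P x.
Proof. by move=> Pa x; rewrite -(jreprK x). Qed.

Lemma jrepr_pi a : I (jrepr (jpi a) - a).
Proof. by apply/jpi_eq; rewrite jreprK. Qed.

Definition jq_scale (k : K) (x : jquot) : jquot := jpi (k *: jrepr x).
Definition jq_mul (x y : jquot) : jquot := jpi (jrepr x ** jrepr y).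

Lemma jq_scaleE k a : jq_scale k (jpi a) = jpi (k *: a).
Proof. by apply/jpi_eq; rewrite -scalerBr; apply/(jidealZ idI)/jrepr_pi. Qed.

Lemma jq_mulE a b : jq_mul (jpi a) (jpi b) = jpi (a ** b).
Proof.
apply/jpi_eq; set a' := jrepr _; set b' := jrepr _.
have -> : a' ** b' - a ** b = (a' - a) ** b' + (b' - b) ** a.
  by rewrite !jmulBl (jmulC b' a) (jmulC b a) addrA subrK.
by apply: (jidealD idI); apply/(jidealM idI)/jrepr_pi.
Qed.

Let jqE := (jq_scaleE, jq_mulE, =^~ jpiD).

Fact jq_scaleA k l x : jq_scale k (jq_scale l x) = jq_scale (k * l) x.
Proof. by elim/jpiW: x => a; rewrite !jqE scalerA. Qed.
Fact jq_scale1 : left_id 1 jq_scale.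
Proof. by elim/jpiW=> a; rewrite !jqE scale1r. Qed.
Fact jq_scaleDr : right_distributive jq_scale +%R.
Proof. by move=> k; elim/jpiW=> a; elim/jpiW=> b; rewrite !jqE scalerDr. Qed.
Fact jq_scaleDl x : {morph jq_scale^~ x : k l / k + l}.
Proof. by elim/jpiW: x => a k l; rewrite !jqE scalerDl. Qed.

HB.instance Definition _ := GRing.Zmodule_isLmodule.Build K jquot
  jq_scaleA jq_scale1 jq_scaleDr jq_scaleDl.

Fact jq_mulC x y : jq_mul x y = jq_mul y x.
Proof. by elim/jpiW: x => a; elim/jpiW: y => b; rewrite !jqE jmulC. Qed.
Fact jq_mulDl x y z : jq_mul (x + y) z = jq_mul x z + jq_mul y z.
Proof.
by elim/jpiW: x => a; elim/jpiW: y => b; elim/jpiW: z => c; rewrite !jqE jmulDl.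
Qed.
Fact jq_mulZl (k : K) (x y : jquot) : jq_mul (k *: x) y = k *: jq_mul x y.
Proof.
elim/jpiW: x => a; elim/jpiW: y => b.
by rewrite /GRing.scale /= !jqE jmulZl.
Qed.
Fact jq_mul1l x : jq_mul (jpi jone) x = x.
Proof. by elim/jpiW: x => a; rewrite !jqE jmul1l. Qed.
Fact jq_jordan x y :
  jq_mul (jq_mul (jq_mul x x) y) x = jq_mul (jq_mul x x) (jq_mul y x).
Proof.
by elim/jpiW: x => a; elim/jpiW: y => b; rewrite !jqE jordan_identity.
Qed.

HB.instance Definition _ := Lmodule_isJordan.Build K jquot
  jq_mulC jq_mulDl jq_mulZl jq_mul1l jq_jordan.

Lemma jpi_hom : jordan_hom jpi.
Proof. by split=> *; rewrite ?jpiD // -?jq_scaleE // -?jq_mulE. Qed.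

End QuotientByIdeal.

(** * Words, normal forms and the abstract form of the identities *)

(** A function of words that is unchanged by the exchange of two neighbours
    only depends on the multiset of letters. *)
Lemma perm_swap_eq (T : eqType) (B : Type) (h : seq T -> B) :
  (forall p a b s, h (p ++ a :: b :: s) = h (p ++ b :: a :: s)) ->
  forall s t, perm_eq s t -> h s = h t.
Proof.
move=> swap s t; elim: s h swap t => [|x s IHs] h swap t.
  by rewrite perm_sym => /perm_nilP ->.
move=> st; have xt : x \in t by rewrite -(perm_mem st) mem_head.
move: st; case/splitPr: xt => t1 t2 st.
have {}st : perm_eq s (t1 ++ t2).
  by move: st; rewrite perm_sym (perm_catCA t1 [:: x] t2) perm_sym perm_cons.
have -> : h (t1 ++ x :: t2) = h (x :: t1 ++ t2).
  elim/last_ind: t1 t2 {st} => //= t1 a IHt t2.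
  by rewrite !cat_rcons swap IHt.
apply: (IHs (fun r => h (x :: r))) st => p a b r.
exact: (swap (x :: p)).
Qed.

Lemma seq_pair_ind (T : Type) (P : seq T -> Prop) :
  P [::] -> (forall a, P [:: a]) -> (forall a b s, P s -> P [:: a, b & s]) ->
  forall s, P s.
Proof.
move=> P0 P1 P2 s; suff [] : P s /\ forall a, P (a :: s) by [].
by elim: s => // b s [Ps Pbs]; split=> // a; apply: P2.
Qed.

(** The identities are stated on homogeneous elements of an arbitrary graded
    algebra, because they are used twice: they drive the calculus in the
    quotient of J(X), and they are checked in the matrix algebra. *)
Record basis_identities (K : fieldType) (A : jordanType K)
    (gr : bool -> set A) : Prop := {
  bid_lcomm : forall p q a b c, gr p a -> gr p b -> gr q c ->
    a ** (b ** c) = b ** (a ** c);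
  bid_deriv_zz : forall u v m n,
    gr false u -> gr false v -> gr true m -> gr true n ->
    jassoc (u ** v) m n =
    u ** jassoc v m n + v ** jassoc u m n - 2%:R *: (m ** jassoc n u v);
  bid_deriv_yz : forall u v w m,
    gr false u -> gr false v -> gr false w -> gr true m ->
    jassoc (u ** v) w m = u ** jassoc v w m + v ** jassoc u w m;
  bid_zz_nucleus : forall p q m n a b, gr true m -> gr true n -> gr p a -> gr q b ->
    jassoc (m ** n) a b = 0;
  bid_swap : forall p u v w m a,
    gr false u -> gr false v -> gr false w -> gr true m -> gr p a ->
    jassoc5 u v m a w = jassoc5 u w m a v
}.

(** This is -(u, m, n).  For even u and odd m, n its value in the matrix algebra
    is b_u e (m n), where b_u is the e-coordinate of u. *)
Definition eterm (K : fieldType) (A : jordanType K) (u m n : A) : A :=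
  u ** (m ** n) - (u ** m) ** n.

Section WordOperators.
Variables (K : fieldType) (A : jordanType K) (y z : nat -> A).

Definition ymul (r : seq nat) (m : A) : A := foldr (fun i => jmul (y i)) m r.
Definition zmul (r : seq nat) (m : A) : A := foldr (fun i => jmul (z i)) m r.

(** The operator b_i b_j b_k ... on the odd part.  Only products of an even
    number of b's act on it; a last unpaired letter is dropped, so the function
    is meaningful on words of even length. *)
Fixpoint bmul (r : seq nat) (m : A) : A :=
  if r is i :: j :: r' then jassoc (y i) (y j) (bmul r' m) else m.

(** Value a^al b^be c^ga w in the matrix algebra, for |be| even and |ga| odd. *)
Definition odd_nf (al be ga : seq nat) : A := ymul al (bmul be (zmul ga jone)).

(** Value a^al b^be c^ga times 1 or e, for |ga| even and positive.  When |be| is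
    odd one letter b cannot be paired; it is carried by an [eterm], which
    produces the factor e. *)
Definition even_nf (al be ga : seq nat) : A :=
  if ga is c :: ga' then
    if odd (size be) then
      if be is b :: be' then eterm (y b) (z c) (odd_nf al be' ga') else 0
    else z c ** odd_nf al be ga'
  else 0.

Lemma ymul_cat r r' m : ymul (r ++ r') m = ymul r (ymul r' m).
Proof. exact: foldr_cat. Qed.

Lemma zmul_cat r r' m : zmul (r ++ r') m = zmul r (zmul r' m).
Proof. exact: foldr_cat. Qed.

End WordOperators.

(** * Consequences of the identities *)
Section StructureTheory.
Variables (K : fieldType) (A : jordanType K) (gr : bool -> set A).
Hypothesis grA : jordan_grading gr.
Hypothesis idA : basis_identities gr.
Local Notation Ev := (gr false).
Local Notation Od := (gr true).
Implicit Types (a b c m n k u v w : A).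

Lemma grEE a b : Ev a -> Ev b -> Ev (a ** b).
Proof. exact: (jgrM grA). Qed.
Lemma grEO a b : Ev a -> Od b -> Od (a ** b).
Proof. exact: (jgrM grA). Qed.
Lemma grOE a b : Od a -> Ev b -> Od (a ** b).
Proof. exact: (jgrM grA). Qed.
Lemma grOO a b : Od a -> Od b -> Ev (a ** b).
Proof. exact: (jgrM grA). Qed.
Lemma gr_one : Ev jone. Proof. exact: (jgr1 grA). Qed.
Lemma grB p a b : gr p a -> gr p b -> gr p (a - b).
Proof.
by move=> ga gb; apply: (jgrD grA) => //; rewrite -scaleN1r; apply: (jgrZ grA).
Qed.

#[local] Hint Resolve grEE grEO grOE grOO gr_one grB : core.

(** Commutativity turns the exchange of two left factors into associativity. *)
Lemma evA u v w : Ev u -> Ev v -> Ev w -> u ** (v ** w) = (u ** v) ** w.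
Proof.
move=> gu gv gw; rewrite (jmulC v) (bid_lcomm idA gu gw gv).
by rewrite jmulC.
Qed.

Lemma ev_comm p u v a : Ev u -> Ev v -> gr p a -> u ** (v ** a) = v ** (u ** a).
Proof. exact: (bid_lcomm idA). Qed.

Lemma od_comm p m n a : Od m -> Od n -> gr p a -> m ** (n ** a) = n ** (m ** a).
Proof. exact: (bid_lcomm idA). Qed.

(** Exchange of odd factors in k (m a), read through commutativity. *)
Lemma od_mulA p m a k : Od m -> gr p a -> Od k -> (m ** a) ** k = m ** (a ** k).
Proof. by move=> gm ga gk; rewrite jmulC (od_comm gk gm ga) (jmulC k). Qed.

Lemma central p q m n a b : Od m -> Od n -> gr p a -> gr q b ->
  ((m ** n) ** a) ** b = (m ** n) ** (a ** b).
Proof.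
move=> gm gn ga gb; apply/eqP; rewrite -subr_eq0; apply/eqP.
exact/(bid_zz_nucleus idA _ _ ga gb).
Qed.

Lemma etermD u m n n' : eterm u m (n + n') = eterm u m n + eterm u m n'.
Proof. by rewrite /eterm !jmulDr opprD addrACA. Qed.

Lemma etermZ (x : K) u m n : eterm u m (x *: n) = x *: eterm u m n.
Proof. by rewrite /eterm !jmulZr scalerBr. Qed.

Lemma jassoc_Od u v m : Ev u -> Ev v -> Od m -> Od (jassoc u v m).
Proof. by rewrite /jassoc; auto 6. Qed.
Lemma eterm_Ev u m n : Ev u -> Od m -> Od n -> Ev (eterm u m n).
Proof. by rewrite /eterm; auto 6. Qed.
#[local] Hint Resolve jassoc_Od eterm_Ev : core.

Lemma jassoc_sym u v m : Ev u -> Ev v -> Od m -> jassoc u v m = jassoc v u m.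
Proof. by move=> *; rewrite /jassoc (@ev_comm true) // (jmulC u). Qed.

(** Operators that act on the odd part like multiplication by a scalar; they
    can be moved freely inside products.  Left multiplications by even elements
    and the operators (u, v, -) are of this kind. *)
Record odd_scalar (T : A -> A) : Prop := {
  os_odd : forall m, Od m -> Od (T m);
  os_B : forall m n, T (m - n) = T m - T n;
  os_ev : forall u m, Ev u -> Od m -> T (u ** m) = u ** T m;
  os_od : forall m n, Od m -> Od n -> T m ** n = m ** T n
}.

Lemma odd_scalar_id : odd_scalar id. Proof. by []. Qed.

(** Moving a composite across a product reverses its factors, hence the
    commutation hypothesis. *)
Lemma odd_scalar_comp T T' :
  odd_scalar T -> odd_scalar T' -> (forall m, Od m -> T (T' m) = T' (T m)) ->
  odd_scalar (T \o T').
Proof.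
move=> [To TB Te Td] [To' TB' Te' Td'] TT'.
split=> /= [m gm|m n|u m gu gm|m n gm gn]; first by auto.
- by rewrite TB' TB.
- by rewrite Te' // Te //; auto.
- by rewrite Td ?Td' ?TT' //; auto.
Qed.

Lemma odd_scalar_mul u : Ev u -> odd_scalar (jmul u).
Proof.
move=> gu; split=> [m gm|m n|v m gv gm|m n gm gn]; first by auto.
- exact: jmulBr.
- exact: (@ev_comm true).
- by rewrite jmulC (jmulC u) (od_comm gn gm gu) (jmulC n).
Qed.

Lemma odd_scalar_jassoc u v : Ev u -> Ev v -> odd_scalar (jassoc u v).
Proof.
move=> gu gv; have guv := grEE gu gv.
have [uo uB ue ud] := odd_scalar_mul gu.
have [vo vB ve vd] := odd_scalar_mul gv.
have [wo wB we wd] := odd_scalar_mul guv.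
split=> [m gm|m n|w m gw gm|m n gm gn]; rewrite /jassoc; first by auto.
- by rewrite wB vB uB !opprD addrACA.
- by rewrite (we w) // (ve w) // (ue w) ?jmulBr //; auto.
- by rewrite jmulBl jmulBr wd // (ud (v ** m)) ?vd ?(ve u) //; auto.
Qed.

Lemma os_jassoc T u v m : odd_scalar T -> Ev u -> Ev v -> Od m ->
  T (jassoc u v m) = jassoc u v (T m).
Proof. by move=> hT *; rewrite /jassoc (os_B hT) !(os_ev hT) //; auto. Qed.

Lemma eterm_slide u m n : Ev u -> Od m -> Od n ->
  eterm u m n = u ** (m ** n) - m ** (u ** n).
Proof. by move=> gu gm gn; rewrite /eterm (os_od (odd_scalar_mul gu)). Qed.

(** The next two lemmas let the first odd letter of a normal form trade places
    with an odd letter buried under the operator T. *)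
Lemma od_exchange T c d a : odd_scalar T -> Od c -> Od d -> Ev a ->
  c ** T (d ** a) = d ** T (c ** a).
Proof.
move=> hT gc gd ga; have gTc := os_odd hT gc.
rewrite -(os_od hT gc (grOE gd ga)) (od_comm gTc gd ga).
by rewrite (jmulC _ a) -(os_ev hT ga gc) (jmulC a).
Qed.

Lemma eterm_exchange T u c d a :
  odd_scalar T -> Ev u -> Od c -> Od d -> Ev a ->
  eterm u c (T (d ** a)) = eterm u d (T (c ** a)).
Proof.
move=> hT gu gc gd ga; have To m (gm : Od m) := os_odd hT gm.
rewrite !eterm_slide //; auto; rewrite (od_exchange hT) //; congr (_ - _).
apply: (@od_exchange (jmul u \o T)) => //.
by apply: (odd_scalar_comp (odd_scalar_mul gu) hT) => m gm; rewrite (os_ev hT).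
Qed.

(** b_a b_u b_v b_w is symmetric in u and v: this is [bid_swap] with an even fourth
    argument, since (M, a, u) = -(a, u, M) for M odd and a, u even. *)
Lemma jassoc_exchange u v w a m : Ev u -> Ev v -> Ev w -> Ev a -> Od m ->
  jassoc a u (jassoc v w m) = jassoc a v (jassoc u w m).
Proof.
move=> gu gv gw ga gm.
have E u' v' : Ev u' -> Ev v' ->
    jassoc a u' (jassoc v' w m) = - jassoc5 w v' m a u'.
  move=> gu' gv'; rewrite /jassoc5 (jassoc_sym gv' gw) //.
  move: (jassoc w v' m) (jassoc_Od gw gv' gm) => n gn.
  by rewrite /jassoc opprB !(jmulC n) (jmulC (a ** n)) (ev_comm gu' ga gn).
by rewrite !E // (bid_swap idA gw gv gu gm ga).
Qed.

(** The same exchange when one of the b's carries the factor e: this is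
    [bid_swap] with an odd fourth argument. *)
Lemma eterm_jassoc_exchange u v w m n : Ev u -> Ev v -> Ev w -> Od m -> Od n ->
  eterm u m (jassoc v w n) = eterm v m (jassoc u w n).
Proof.
move=> gu gv gw gm gn.
have E u' v' : Ev u' -> Ev v' ->
    eterm u' m (jassoc v' w n) = jassoc5 w v' n m u'.
  move=> gu' gv'; rewrite /jassoc5 (jassoc_sym gv' gw) //.
  move: (jassoc w v' n) => k.
  by rewrite /eterm /jassoc (jmulC (k ** m)) !(jmulC k) (jmulC m u').
by rewrite !E // (bid_swap idA gw gv gu gn gm).
Qed.

(** The additive bookkeeping that turns [bid_deriv_zz] into the next lemma. *)
Fact ev_eterm_aux (V : zmodType) (P Q R S T : V) :
  Q - P = R - P + (S - P) - (T - Q) *+ 2 -> P - S = R - T + (Q - T).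
Proof.
rewrite -mulNrn opprB mulr2n => /eqP.
rewrite (AC ((2*2)*(2*2)) ((5*2)*(((1*6)*(7*8))*(3*4)))).
rewrite -[X in X == _]addr0 (inj_eq (addrI _)) eq_sym addr_eq0 => /eqP ->.
by rewrite opprB.
Qed.

(** In coordinates, (a_v + b_v e) b_u e = a_v b_u e + b_u b_v.  This is
    what [bid_deriv_zz] amounts to in the presence of the other identities. *)
Lemma ev_eterm u v m n : Ev u -> Ev v -> Od m -> Od n ->
  v ** eterm u m n = eterm u m (v ** n) + m ** jassoc u v n.
Proof.
move=> gu gv gm gn; have := bid_deriv_zz idA gu gv gm gn.
rewrite /jassoc scaler_nat.
rewrite /eterm.
have hu := odd_scalar_mul gu; have hv := odd_scalar_mul gv.
have huv := odd_scalar_mul (grEE gu gv); have gvn := grEO gv gn.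
rewrite (jmulC n (u ** v)) (jmulC n u) (jmulC (u ** n)) (ev_comm gv gu gn).
rewrite !jmulBr (os_od huv gm gn) (os_od hv gm gn) (os_od hu gm gn).
rewrite (os_od hu gm gvn) (ev_comm gv gu (grOO gm gn)).
rewrite (evA gu gv (grOO gm gn)).
exact: ev_eterm_aux.
Qed.

(** * Normal forms do not depend on the order of the letters *)
Section NormalForms.
Variables y z : nat -> A.
Hypothesis gy : forall i, Ev (y i).
Hypothesis gz : forall i, Od (z i).
Local Notation ymul := (ymul y).
Local Notation zmul := (zmul z).
Local Notation bmul := (bmul y).
Local Notation odd_nf := (odd_nf y z).
Local Notation even_nf := (even_nf y z).
Local Notation ytz al := (ymul al jone).
Local Notation ztz ga := (zmul ga jone).
Implicit Types al be ga : seq nat.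

#[local] Hint Resolve gy gz : core.

Lemma os_ymul al : odd_scalar (ymul al).
Proof.
elim: al => [|i al IH]; first exact: odd_scalar_id.
by apply: (odd_scalar_comp (odd_scalar_mul (gy i)) IH) => m gm; rewrite (os_ev IH).
Qed.

Lemma os_bmul be : odd_scalar (bmul be).
Proof.
elim/seq_pair_ind: be => [|i|i j be IH]; try exact: odd_scalar_id.
apply: (odd_scalar_comp (odd_scalar_jassoc (gy i) (gy j)) IH) => m gm.
by rewrite (os_jassoc IH).
Qed.

Definition oscal al be (m : A) : A := ymul al (bmul be m).

Lemma os_oscal al be : odd_scalar (oscal al be).
Proof.
apply: (odd_scalar_comp (os_ymul al) (os_bmul be)).
elim: al => //= i al IH m gm; rewrite IH // (os_ev (os_bmul be)) //.
exact: (os_odd (os_ymul al)).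
Qed.

Lemma odd_nfE al be ga : odd_nf al be ga = oscal al be (ztz ga).
Proof. by []. Qed.

Lemma bmul_cat be be' m : ~~ odd (size be) ->
  bmul (be ++ be') m = bmul be (bmul be' m).
Proof. by elim/seq_pair_ind: be => //= i j be IH; rewrite negbK => /IH ->. Qed.

Lemma oscal_cat al al' be be' m : ~~ odd (size be) -> Od m ->
  oscal al be (oscal al' be' m) = oscal (al ++ al') (be ++ be') m.
Proof.
move=> ebe gm; rewrite /oscal bmul_cat // ymul_cat; congr (ymul _ _).
have := os_odd (os_bmul be') gm; move: (bmul be' m) => n gn.
elim: al' => //= i al' IH; rewrite -IH (os_ev (os_bmul be)) //.
exact: (os_odd (os_ymul al')).
Qed.

Lemma gr_ztz ga : gr (odd (size ga)) (ztz ga).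
Proof. by elim: ga => //= c ga; apply: (jgrM grA (p := true)). Qed.

Lemma Od_ztz ga : odd (size ga) -> Od (ztz ga).
Proof. by move=> oga; have := gr_ztz ga; rewrite oga. Qed.

Lemma Ev_ztz ga : ~~ odd (size ga) -> Ev (ztz ga).
Proof. by move=> /negPf ega; have := gr_ztz ga; rewrite ega. Qed.

Lemma Ev_ytz al : Ev (ytz al).
Proof. by elim: al => //= i al IH; auto. Qed.

Lemma Od_oscal al be m : Od m -> Od (oscal al be m).
Proof. exact: (os_odd (os_oscal al be)). Qed.

Lemma Od_nf al be ga : odd (size ga) -> Od (odd_nf al be ga).
Proof. by move=> oga; apply/Od_oscal/Od_ztz. Qed.

#[local] Hint Resolve Od_ztz Ev_ztz Ev_ytz Od_oscal Od_nf : core.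

Lemma ztz_mul ga k : Od k -> ztz ga ** k = zmul ga k.
Proof.
move=> gk; elim: ga => [|c ga IH] /=; first exact: jmul1l.
by rewrite (od_mulA _ (gr_ztz ga)) // IH.
Qed.

Lemma ztz_cat ga ga' : odd (size ga') -> ztz ga ** ztz ga' = ztz (ga ++ ga').
Proof. by move=> o; rewrite ztz_mul ?zmul_cat //; auto. Qed.

Lemma ymul_perm al al' m : Od m -> perm_eq al al' -> ymul al m = ymul al' m.
Proof.
move=> gm; apply: (@perm_swap_eq _ _ (ymul^~ m)) => p a b s.
rewrite !ymul_cat /=; congr (ymul _ _); apply: (@ev_comm true) => //.
exact: (os_odd (os_ymul s)).
Qed.

Lemma ytz_perm al al' : perm_eq al al' -> ytz al = ytz al'.
Proof.
apply: (@perm_swap_eq _ _ (fun r => ytz r)) => p a b s.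
rewrite !ymul_cat /=; congr (ymul _ _); apply: (@ev_comm false) => //.
Qed.

Lemma ztz_perm ga ga' : perm_eq ga ga' -> ztz ga = ztz ga'.
Proof.
apply: (@perm_swap_eq _ _ (fun r => ztz r)) => p a b s.
rewrite !zmul_cat /=; congr (zmul _ _).
by apply: (od_comm _ _ (gr_ztz s)).
Qed.

(** Neighbours inside one pair are exchanged by the symmetry of (u, v, m) in u
    and v, and neighbours in adjacent pairs by [jassoc_exchange]; hence the
    induction two letters at a time. *)
Lemma bmul_swap (p s : seq nat) (a b : nat) m :
  Od m -> ~~ odd (size (p ++ a :: b :: s)) ->
  bmul (p ++ a :: b :: s) m = bmul (p ++ b :: a :: s) m.
Proof.
move=> gm; elim/seq_pair_ind: p => [|c|c d p IH] /=.
- by move=> _; apply: jassoc_sym => //; apply: (os_odd (os_bmul s)).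
- case: s => //= d s _; have := os_odd (os_bmul s) gm.
  move: (bmul s m) => n gn.
  exact: jassoc_exchange.
- by rewrite negbK => /IH ->.
Qed.

Lemma odd_nf_perm al al' be be' ga ga' :
  ~~ odd (size be) -> odd (size ga) ->
  perm_eq al al' -> perm_eq be be' -> perm_eq ga ga' ->
  odd_nf al be ga = odd_nf al' be' ga'.
Proof.
move=> ebe oga pal pbe pga; rewrite !odd_nfE -(ztz_perm pga) /oscal.
have gm := Od_ztz oga; move: (ztz ga) gm => m gm.
rewrite (ymul_perm _ pal); last exact: (os_odd (os_bmul be)).
congr (ymul _ _).
pose h r := if odd (size r) then 0 else bmul r m.
have hE r : perm_eq be r -> h r = bmul r m.
  by move=> /perm_size E; rewrite /h -E (negPf ebe).
rewrite -!hE //; apply: perm_swap_eq pbe => p a b s.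
rewrite /h !size_cat /= -[(size p + _)%N]/((size p + size (b :: a :: s))%N).
rewrite -size_cat; case: ifPn => // ev.
by apply: bmul_swap; rewrite // size_cat /= -(size_cat p (b :: a :: s)).
Qed.

Lemma even_nf_perm al al' be be' ga ga' :
  ~~ odd (size ga) ->
  perm_eq al al' -> perm_eq be be' -> perm_eq ga ga' ->
  even_nf al be ga = even_nf al' be' ga'.
Proof.
move=> ega pal pbe pga.
transitivity (even_nf al be ga').
  pose h r := if odd (size r) then 0 else even_nf al be r.
  have hE r : perm_eq ga r -> h r = even_nf al be r.
    by move=> /perm_size E; rewrite /h -E (negPf ega).
  rewrite -!hE //; apply: perm_swap_eq pga => -[|e p] a b s; rewrite /h /=.
    rewrite negbK; case: ifPn => // es; case: ifP => obe.
      case: be {pbe h hE} obe => //= d be _.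
      exact: (eterm_exchange (os_oscal al be) (gy d) (gz a) (gz b) (Ev_ztz es)).
    exact: (od_exchange (os_oscal al be) (gz a) (gz b) (Ev_ztz es)).
  rewrite !size_cat /=; case: ifP => // _.
  have E r : odd_nf al r (p ++ a :: b :: s) = odd_nf al r (p ++ b :: a :: s).
    rewrite !odd_nfE (@ztz_perm _ (p ++ b :: a :: s)) //.
    by rewrite perm_cat2l (perm_catCA [:: a] [:: b]).
  by rewrite E; case: be {pbe h hE} => //= d be; rewrite E.
have {}ega : ~~ odd (size ga') by rewrite -(perm_size pga).
transitivity (even_nf al' be ga').
  case: ga' ega {pga} => //= c g; rewrite negbK => og.
  have E r : odd_nf al r g = odd_nf al' r g.
    apply: ymul_perm => //; apply: (os_odd (os_bmul r)); auto.
  by rewrite E; case: be {pbe} => //= b be; rewrite E.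
case: ga' ega {pga} => //= c g; rewrite negbK => og.
apply: (@perm_swap_eq _ _ (fun r => even_nf al' r (c :: g))) pbe => p a b s.
rewrite /= !size_cat /=; case: ifPn => odds.
  case: p odds => [|e p] /=.
    case: s => //= d s /negPf es.
    have gM := os_odd (os_bmul s) (Od_ztz og).
    rewrite !odd_nfE /oscal /= !(os_jassoc (os_ymul al')) //.
    apply: eterm_jassoc_exchange; auto.
    exact: (os_odd (os_ymul al')).
  rewrite -[(size p + _)%N](size_cat p (a :: b :: s)) => es.
  by rewrite !odd_nfE /oscal bmul_swap //; auto.
rewrite !odd_nfE /oscal bmul_swap ?size_cat //; auto.
Qed.

(** * The span of the normal forms is closed under products *)
Definition odd_nfs : set A := [set x | exists al be ga,
  [/\ ~~ odd (size be), odd (size ga) & x = odd_nf al be ga]].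

Definition even_nfs : set A :=
  [set x | exists al be ga,
     [/\ ga != [::], ~~ odd (size ga) & x = even_nf al be ga]]
  `|` [set x | exists al, x = ytz al].

Local Notation W0 := (span_of even_nfs).
Local Notation W1 := (span_of odd_nfs).

Lemma span_odd_nf al be ga : ~~ odd (size be) -> odd (size ga) ->
  W1 (odd_nf al be ga).
Proof. by move=> ebe oga; apply: span_of_gen; exists al, be, ga. Qed.

Lemma span_even_nf al be ga : ga != [::] -> ~~ odd (size ga) ->
  W0 (even_nf al be ga).
Proof. by move=> ga0 ega; apply: span_of_gen; left; exists al, be, ga. Qed.

Lemma span_ytz al : W0 (ytz al).
Proof. by apply: span_of_gen; right; exists al. Qed.

Lemma odd_span_Od x : W1 x -> Od x.
Proof.
elim/span_of_ind: x / => [|a b|k a|_ [al [be [ga [_ oga ->]]]]]; auto.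
- exact: (jgr0 grA).
- exact: (jgrD grA).
- exact: (jgrZ grA).
Qed.

Lemma even_nf_Ev al be ga : ~~ odd (size ga) -> Ev (even_nf al be ga).
Proof.
case: ga => [|c g] /=; first by move=> _; apply: (jgr0 grA).
rewrite negbK => og; case: ifP => _; last by auto.
by case: be => [|b be]; [apply: (jgr0 grA) | auto].
Qed.

Lemma even_span_Ev x : W0 x -> Ev x.
Proof.
elim/span_of_ind: x / => [|a b|k a|_ [[al [be [ga [_ ega ->]]]]|[al ->]]]; auto.
- exact: (jgr0 grA).
- exact: (jgrD grA).
- exact: (jgrZ grA).
- exact: even_nf_Ev.
Qed.

#[local] Hint Resolve odd_span_Od even_span_Ev : core.

Lemma odd_span_y i x : W1 x -> W1 (y i ** x).
Proof.
apply: span_of_map => [||_ [al [be [ga [ebe oga ->]]]]]; first exact: jmulDr.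
  by move=> k a; apply: jmulZr.
exact: (@span_odd_nf (i :: al)).
Qed.

Lemma odd_span_jassoc i j x : W1 x -> W1 (jassoc (y i) (y j) x).
Proof.
apply: span_of_map => [a b|k a|_ [al [be [ga [ebe oga ->]]]]].
- by rewrite /jassoc !jmulDr opprD addrACA.
- by rewrite /jassoc !jmulZr scalerBr.
rewrite odd_nfE -(os_jassoc (os_ymul al)) //;
  last exact: (os_odd (os_bmul be)) (Od_ztz oga).
by apply: (@span_odd_nf al [:: i, j & be]) => //=; rewrite negbK.
Qed.

Lemma even_span_z (c : nat) x : W1 x -> W0 (z c ** x).
Proof.
apply: span_of_map => [||_ [al [be [ga [ebe oga ->]]]]]; first exact: jmulDr.
  by move=> k a; apply: jmulZr.
have := @span_even_nf al be (c :: ga); rewrite /= (negPf ebe) negbK.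
exact.
Qed.

Lemma even_span_eterm (b c : nat) x : W1 x -> W0 (eterm (y b) (z c) x).
Proof.
apply: span_of_map => [||_ [al [be [ga [ebe oga ->]]]]]; first exact: etermD.
  by move=> k a; apply: etermZ.
have := @span_even_nf al (b :: be) (c :: ga); rewrite /= (negPf ebe) negbK.
exact.
Qed.

Lemma odd_span_mul x x' : W1 x -> W1 x' -> W0 (x ** x').
Proof.
apply: span_of_mul => _ _ [al [be [ga [ebe oga ->]]]]
  [al' [be' [ga' [ebe' oga' ->]]]].
case: ga oga => //= c g eg.
have gc : Od (ztz (c :: g)) := Od_ztz (ga := c :: g) eg.
rewrite !odd_nfE (os_od (os_oscal al be) gc); auto.
rewrite oscal_cat //; auto.
rewrite (od_mulA (gz c) (Ev_ztz eg)); auto.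
rewrite -(os_ev (os_oscal _ _)) //; auto.
rewrite ztz_cat //; apply/even_span_z/span_odd_nf; rewrite ?size_cat ?oddD.
  by rewrite (negPf ebe) (negPf ebe').
by rewrite (negPf eg) oga'.
Qed.

(** Left multiplication by a word in the y's; the associator (y_i, word, -) has
    to be treated at the same time because y_j v acts as y_j composed with v,
    plus (y_j, v, -), and [bid_deriv_yz] shortens the word in that
    associator. *)
Lemma odd_span_ytz al k : W1 k ->
  W1 (ytz al ** k) /\ forall i, W1 (jassoc (y i) (ytz al) k).
Proof.
elim: al k => [|j al IH] k Wk /=.
  split=> [|i]; first by rewrite jmul1l.
  by rewrite /jassoc jmul1r jmul1l subrr; apply: span_of0.
have E i : jassoc (y i) (ytz al) k = (y i ** ytz al) ** k - y i ** (ytz al ** k).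
  by [].
split=> [|i].
  rewrite -(subrK (y j ** (ytz al ** k)) (_ ** k)) -E.
  by apply: span_ofD; [apply: (IH k Wk).2 | apply/odd_span_y/(IH k Wk).1].
rewrite jassoc_sym //; auto.
rewrite (bid_deriv_yz idA) //; auto.
apply: span_ofD; last exact/(IH _ _).1/odd_span_jassoc.
by rewrite (jassoc_sym (Ev_ytz al) (gy i)); auto; apply/odd_span_y/(IH k Wk).2.
Qed.

(** The abstract form of ew = 0. *)
Lemma eterm_annihilates_odd u m n k : Ev u -> Od m -> Od n -> Od k ->
  eterm u m n ** k = 0.
Proof.
move=> gu gm gn gk; have gmn := grOO gm gn; have gnk := grOO gn gk.
rewrite /eterm jmulBl (jmulC u) (central gm gn gu gk).
rewrite (ev_comm gmn gu gk) (od_mulA gm gn gk).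
rewrite (od_mulA (grEO gu gm) gn gk) (jmulC (u ** m)) (ev_comm gnk gu gm).
by rewrite (jmulC (n ** k)) subrr.
Qed.

Lemma even_odd_span_mul u k : W0 u -> W1 k -> W1 (u ** k).
Proof.
apply: span_of_mul => _ _ [[al [be [ga [_ ega ->]]]]|[al ->]]
  [al' [be' [ga' [ebe' oga' ->]]]]; last first.
  exact/(odd_span_ytz _ _).1/span_odd_nf.
have Wk := span_odd_nf al' ebe' oga'.
case: ga ega => [|c g] /=; first by rewrite jmul0l => _; apply: span_of0.
rewrite negbK => og; case: ifPn => [obe|ebe].
  case: be obe => //= b be _.
  by rewrite eterm_annihilates_odd //; auto; apply: span_of0.
rewrite !odd_nfE -(os_ev (os_oscal al' be')); auto.
rewrite -(os_od (os_oscal al be)); auto.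
rewrite (od_mulA _ (Od_ztz og)) //; auto.
rewrite (jmulC _ (ztz g ** _)) -(os_ev (os_oscal al be)); auto.
rewrite ztz_cat // (jmulC _ (z c)) oscal_cat //; last first.
  by apply: grOE => //; apply: Ev_ztz; rewrite size_cat oddD og oga'.
rewrite -[z c ** _]/(ztz (c :: (g ++ ga'))); apply: span_odd_nf.
  by rewrite size_cat oddD (negPf ebe) (negPf ebe').
by rewrite /= size_cat oddD og oga'.
Qed.

(** Products of two odd elements are central; the next two lemmas push such a
    factor into the last argument of an even normal form. *)
Lemma central_slide m n k l : Od m -> Od n -> Od k -> Od l ->
  (m ** n) ** (k ** l) = k ** ((m ** n) ** l).
Proof.
move=> gm gn gk gl; rewrite -(central gm gn gk gl).
exact: (os_od (odd_scalar_mul (grOO gm gn))).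
Qed.

Lemma central_eterm m n u k l : Od m -> Od n -> Ev u -> Od k -> Od l ->
  (m ** n) ** eterm u k l = eterm u k ((m ** n) ** l).
Proof.
move=> gm gn gu gk gl; rewrite /eterm jmulBr.
rewrite (ev_comm (grOO gm gn) gu (grOO gk gl)).
by rewrite !(central_slide gm gn) //; auto.
Qed.

Lemma even_span_y i u : W0 u -> W0 (y i ** u).
Proof.
apply: span_of_map => [||_ [[al [be [ga [_ ega ->]]]]|[al ->]]].
- exact: jmulDr.
- by move=> k a; apply: jmulZr.
- case: ga ega => [|c g] /=; first by rewrite jmul0r => _; apply: span_of0.
  rewrite negbK => og; case: ifPn => [|ebe].
    case: be => //= b be ebe; have Wm := span_odd_nf al ebe og.
    rewrite ev_eterm //; auto.
    apply: span_ofD; first exact/even_span_eterm/odd_span_y.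
    exact/even_span_z/odd_span_jassoc.
  have Wm := span_odd_nf al ebe og.
  rewrite -(subrK ((y i ** z c) ** odd_nf al be g) (y i ** _)).
  rewrite -/(eterm _ _ _) (os_od (odd_scalar_mul (gy i))) //; auto.
  by apply: span_ofD; [apply: even_span_eterm | apply/even_span_z/odd_span_y].
- exact: (@span_ytz (i :: al)).
Qed.

Lemma even_span_ytz al u : W0 u -> W0 (ytz al ** u).
Proof.
move=> Wu; elim: al => [|i al IH] /=; first by rewrite jmul1l.
by rewrite -evA //; auto; apply: even_span_y.
Qed.

Lemma even_span_central x x' u : W1 x -> W1 x' -> W0 u -> W0 ((x ** x') ** u).
Proof.
move=> Wx Wx'; have Wc := odd_span_mul Wx Wx'.
apply: span_of_map => [||_ [[al [be [ga [_ ega ->]]]]|[al ->]]].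
- exact: jmulDr.
- by move=> k a; apply: jmulZr.
- case: ga ega => [|c g] /=; first by rewrite jmul0r => _; apply: span_of0.
  rewrite negbK => og; case: ifPn => [|ebe].
    case: be => //= b be ebe; have Wm := span_odd_nf al ebe og.
    by rewrite central_eterm //; auto; apply/even_span_eterm/even_odd_span_mul.
  have Wm := span_odd_nf al ebe og.
  by rewrite central_slide //; auto; apply/even_span_z/even_odd_span_mul.
- by rewrite jmulC; apply: even_span_ytz.
Qed.

Lemma odd_span_z (c : nat) : W1 (z c).
Proof. by rewrite -(jmul1r (z c)); apply: (@span_odd_nf [::] [::] [:: c]). Qed.

Lemma even_span_mul u v : W0 u -> W0 v -> W0 (u ** v).
Proof.
move=> Wu Wv; move: u Wu; apply: (span_of_map (f := jmul^~ v)).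
- by move=> a b; apply: jmulDl.
- by move=> k a; apply: jmulZl.
move=> _ [[al [be [ga [_ ega ->]]]]|[al ->]]; last exact: even_span_ytz.
case: ga ega => [|c g] /=; first by rewrite jmul0l => _; apply: span_of0.
rewrite negbK => og; case: ifPn => [|ebe]; last first.
  exact/even_span_central/Wv/span_odd_nf/og/ebe/odd_span_z.
case: be => //= b be ebe; have Wm := span_odd_nf al ebe og.
have Wz := odd_span_z c.
rewrite /eterm jmulBl -evA //; auto.
apply: span_ofB.
  exact/even_span_y/even_span_central.
by apply: even_span_central => //; apply: odd_span_y.
Qed.

End NormalForms.

(** By the closure properties, the even and the odd span together contain every
    value of a nonassociative word. *)
Lemma normal_form_span (s : gvar -> A) f :
  (forall x, gr (var_deg x) (s x)) ->
  let y i := s (Yvar i) in let z i := s (Zvar i) in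
  exists u v, [/\ span_of (even_nfs y z) u, span_of (odd_nfs y z) v &
    fj_eval s f = u + v].
Proof.
move=> gs y z.
have gy i : Ev (y i) := gs (Yvar i).
have gz i : Od (z i) := gs (Zvar i).
elim/fjW: f => t; rewrite fj_evalE.
elim: t => [[i|i]|||t [u [v [Wu Wv E]]] t' [u' [v' [Wu' Wv' E']]]
  |t [u [v [Wu Wv E]]]|k t [u [v [Wu Wv E]]]
  |t [u [v [Wu Wv E]]] t' [u' [v' [Wu' Wv' E']]]] /=; rewrite ?{}E ?{}E'.
- exists (y i), 0; rewrite addr0; split=> //; last exact: span_of0.
  by rewrite -(jmul1r (y i)); apply: (@span_ytz y z [:: i]).
- exists 0, (z i); rewrite add0r; split=> //; first exact: span_of0.
  exact: odd_span_z.
- by exists 0, 0; rewrite addr0; split=> //; exact: span_of0.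
- exists jone, 0; rewrite addr0; split=> //; last exact: span_of0.
  exact: (@span_ytz y z [::]).
- exists (u + u'), (v + v'); rewrite addrACA; split=> //; exact: span_ofD.
- exists (- u), (- v); rewrite opprD; split=> //;
    by rewrite -scaleN1r; apply: span_ofZ.
- by exists (k *: u), (k *: v); rewrite scalerDr; split=> //; exact: span_ofZ.
exists (u ** u' + v ** v'), (u' ** v + u ** v'); split.
- by apply: span_ofD; [apply: even_span_mul | apply: odd_span_mul].
- by apply: span_ofD; apply: even_odd_span_mul.
rewrite jmulDl !jmulDr (jmulC v u').
by rewrite (AC (2*2) ((1*4)*(3*2))).
Qed.

End StructureTheory.

(** * The matrix algebra in coordinates *)
Lemma ord2_ind (P : 'I_2 -> Prop) : P 0 -> P 1 -> forall i, P i.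
Proof.
by move=> P0 P1 [[|[|//]] lti]; [move: P0 | move: P1]; congr P; apply: val_inj.
Qed.

Section Sym2Coordinates.
Variables (K : fieldType) (K2 : 2%N \notin [pchar K]).
Local Notation S := (sym2 K2).
Local Notation sym2_gr := (sym2_gr (K2 := K2)).
Implicit Types (p q r : K) (u v : S).

Let two_neq0 : 2 != 0 :> K := sym2_two_neq0 K2.

(** Diagonal entries p, q and off-diagonal entry r.  These coordinates make the
    product diagonal on the even part; p = a + b and q = a - b for a + be. *)
Definition sym2_mx p q r : 'M[K]_2 :=
  \matrix_(i, j) if i == j then if i == 0 then p else q else r.

Fact sym2_mx_sym p q r : sym2_mx p q r \in @sym2_pred K.
Proof.
rewrite unfold_in; apply/eqP/matrixP => i j; rewrite !mxE eq_sym.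
by case: eqP => // ->.
Qed.

Definition sym2_mk p q r : S := Sym2 K2 (sym2_mx_sym p q r).

Lemma sym2E u : u = sym2_mk (sym2_val u 0 0) (sym2_val u 1 1) (sym2_val u 0 1).
Proof.
apply: val_inj; apply/matrixP => i j; rewrite mxE /=.
have /eqP/matrixP := valP u => /(_ 0 1); rewrite mxE => E.
by elim/ord2_ind: i; elim/ord2_ind: j => //=; rewrite -E.
Qed.

Lemma sym2_mkD p q r p' q' r' :
  sym2_mk p q r + sym2_mk p' q' r' = sym2_mk (p + p') (q + q') (r + r').
Proof. by apply: val_inj; apply/matrixP => i j; rewrite !mxE; do 2?case: ifP. Qed.

Lemma sym2_mkZ k p q r : k *: sym2_mk p q r = sym2_mk (k * p) (k * q) (k * r).
Proof. by apply: val_inj; apply/matrixP => i j; rewrite !mxE; do 2?case: ifP. Qed.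

Lemma sym2_mkN p q r : - sym2_mk p q r = sym2_mk (- p) (- q) (- r).
Proof. by rewrite -scaleN1r sym2_mkZ !mulN1r. Qed.

Lemma sym2_mk0 : 0 = sym2_mk 0 0 0.
Proof. by rewrite -(scale0r (sym2_mk 0 0 0)) sym2_mkZ !mul0r. Qed.

Lemma sym2_mk1 : jone = sym2_mk 1 1 0.
Proof.
apply: val_inj; apply/matrixP => i j; rewrite !mxE.
by case: eqP => //; case: ifP.
Qed.

Lemma sym2_mkM p q r p' q' r' : sym2_mk p q r ** sym2_mk p' q' r' =
  sym2_mk (p * p' + r * r') (q * q' + r * r')
     (2%:R^-1 * ((p + q) * r' + (p' + q') * r)).
Proof.
apply: val_inj; apply/matrixP => i j.
rewrite /jmul /= !mxE !big_ord_recl !big_ord0 !mxE.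
by elim/ord2_ind: i; elim/ord2_ind: j => /=; field.
Qed.

Lemma sym2_gr0E u : sym2_gr false u <-> exists p q, u = sym2_mk p q 0.
Proof.
split=> [|[p [q ->]]].
  rewrite /Defs.sym2_gr /= => gu.
  suff E : sym2_val u 0 1 = 0 by rewrite (sym2E u) E; eauto.
  move: (sym2_val u) gu => M; elim/span_of_ind: M /.
  - by rewrite mxE.
  - by move=> M N HM HN; rewrite mxE HM HN addr0.
  - by move=> k M HM; rewrite mxE HM mulr0.
  - by move=> M [->|->]; rewrite !mxE /= ?addr0 ?subr0.
rewrite /Defs.sym2_gr /=; have -> : sym2_mx p q 0 =
    ((p + q) / 2) *: (delta_mx 0 0 + delta_mx 1 1) +
    ((p - q) / 2) *: (delta_mx 0 0 - delta_mx 1 1).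
  apply/matrixP => i j; rewrite !mxE.
  by elim/ord2_ind: i; elim/ord2_ind: j => /=; field.
by apply: span_ofD; apply/span_ofZ/span_of_gen; [left | right].
Qed.

Lemma sym2_gr1E u : sym2_gr true u <-> exists r, u = sym2_mk 0 0 r.
Proof.
split=> [|[r ->]].
  rewrite /Defs.sym2_gr /= => gu.
  suff [E E'] : sym2_val u 0 0 = 0 /\ sym2_val u 1 1 = 0.
    by rewrite (sym2E u) E E'; eauto.
  move: (sym2_val u) gu => M; elim/span_of_ind: M /.
  - by rewrite !mxE.
  - by move=> M N [HM HM'] [HN HN']; rewrite !mxE HM HN HM' HN' addr0.
  - by move=> k M [HM HM']; rewrite !mxE HM HM' mulr0.
  - by move=> M ->; rewrite !mxE /= ?addr0.
rewrite /Defs.sym2_gr /=.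
have -> : sym2_mx 0 0 r = r *: (delta_mx 0 1 + delta_mx 1 0).
  apply/matrixP => i j; rewrite !mxE.
  by elim/ord2_ind: i; elim/ord2_ind: j => /=; ring.
by apply/span_ofZ/span_of_gen.
Qed.

Lemma sym2_grP b u : sym2_gr b u ->
  exists p q r, u = if b then sym2_mk 0 0 r else sym2_mk p q 0.
Proof.
by case: b => [/sym2_gr1E[r ->]|/sym2_gr0E[p [q ->]]];
  [exists 0, 0, r | exists p, q, 0].
Qed.

Lemma sym2_grading : jordan_grading sym2_gr.
Proof.
split.
- by case; [apply/sym2_gr1E; exists 0 | apply/sym2_gr0E;
    exists 0, 0]; rewrite sym2_mk0.
- case=> a b.
    move=> /sym2_gr1E[r ->] /sym2_gr1E[r' ->]; apply/sym2_gr1E.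
    by exists (r + r'); rewrite sym2_mkD addr0.
  move=> /sym2_gr0E[p [q ->]] /sym2_gr0E[p' [q' ->]]; apply/sym2_gr0E.
  by exists (p + p'), (q + q'); rewrite sym2_mkD addr0.
- case=> k a.
    move=> /sym2_gr1E[r ->]; apply/sym2_gr1E.
    by exists (k * r); rewrite sym2_mkZ mulr0.
  move=> /sym2_gr0E[p [q ->]]; apply/sym2_gr0E.
  by exists (k * p), (k * q); rewrite sym2_mkZ mulr0.
- by apply/sym2_gr0E; exists 1, 1; rewrite sym2_mk1.
case=> -[] a b.
- move=> /sym2_gr1E[r ->] /sym2_gr1E[r' ->]; apply/sym2_gr0E.
  by exists (r * r'), (r * r'); rewrite sym2_mkM; congr sym2_mk; field.
- move=> /sym2_gr1E[r ->] /sym2_gr0E[p [q ->]]; apply/sym2_gr1E.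
  by eexists; rewrite sym2_mkM; congr sym2_mk; ring.
- move=> /sym2_gr0E[p [q ->]] /sym2_gr1E[r ->]; apply/sym2_gr1E.
  by eexists; rewrite sym2_mkM; congr sym2_mk; ring.
- move=> /sym2_gr0E[p [q ->]] /sym2_gr0E[p' [q' ->]]; apply/sym2_gr0E.
  by exists (p * p'), (q * q'); rewrite sym2_mkM; congr sym2_mk; ring.
Qed.

Lemma sym2_basis_identities : basis_identities sym2_gr.
Proof.
split; rewrite /jassoc5 /jassoc.
- move=> b b' u v w /sym2_grP[p [q [r ->]]] /sym2_grP[p' [q' [r' ->]]].
  move=> /sym2_grP[p'' [q'' [r'' ->]]].
  by case: b; case: b'; rewrite !sym2_mkM; congr sym2_mk; field.
- move=> u v m n /sym2_gr0E[p [q ->]] /sym2_gr0E[p' [q' ->]].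
  move=> /sym2_gr1E[r ->] /sym2_gr1E[r' ->].
  by rewrite !(sym2_mkM, sym2_mkN, sym2_mkD, sym2_mkZ); congr sym2_mk; field.
- move=> u v w m /sym2_gr0E[p [q ->]] /sym2_gr0E[p' [q' ->]].
  move=> /sym2_gr0E[p'' [q'' ->]] /sym2_gr1E[r ->].
  by rewrite !(sym2_mkM, sym2_mkN, sym2_mkD, sym2_mkZ); congr sym2_mk; field.
- move=> b b' m n a a' /sym2_gr1E[r ->] /sym2_gr1E[r' ->].
  move=> /sym2_grP[p1 [q1 [r1 ->]]] /sym2_grP[p2 [q2 [r2 ->]]].
  by rewrite sym2_mk0; case: b; case: b';
    rewrite !(sym2_mkM, sym2_mkN, sym2_mkD); congr sym2_mk; field.
- move=> b u v w m a /sym2_gr0E[p [q ->]] /sym2_gr0E[p' [q' ->]].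
  move=> /sym2_gr0E[p'' [q'' ->]] /sym2_gr1E[r ->] /sym2_grP[p1 [q1 [r1 ->]]].
  by case: b; rewrite !(sym2_mkM, sym2_mkN, sym2_mkD); congr sym2_mk; field.
Qed.

(** Values of the normal forms at the point y_i = a_i + b_i e, z_i = c_i w.  On
    the even part p = q means a multiple of 1 and q = -p a multiple of e. *)
Section GenericPoint.
Variables a b c : nat -> K.

Definition gen_y i : S := sym2_mk (a i + b i) (a i - b i) 0.
Definition gen_z i : S := sym2_mk 0 0 (c i).

Lemma ytz_gen al : ymul gen_y al jone =
  sym2_mk (\prod_(i <- al) (a i + b i)) (\prod_(i <- al) (a i - b i)) 0.
Proof.
elim: al => [|i al IH] /=; first by rewrite !big_nil sym2_mk1.
by rewrite IH !big_cons sym2_mkM; congr sym2_mk; ring.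
Qed.

Lemma ztz_gen ga : zmul gen_z ga jone =
  let w := \prod_(i <- ga) c i in
  if odd (size ga) then sym2_mk 0 0 w else sym2_mk w w 0.
Proof.
elim: ga => [|i ga IH] /=; first by rewrite big_nil sym2_mk1.
rewrite IH big_cons; case: (odd _); rewrite /= sym2_mkM; congr sym2_mk; try ring.
by field.
Qed.

Lemma odd_nf_gen al be ga : ~~ odd (size be) -> odd (size ga) ->
  odd_nf gen_y gen_z al be ga =
  sym2_mk 0 0 ((\prod_(i <- al) a i) * (\prod_(i <- be) b i) * \prod_(i <- ga) c i).
Proof.
move=> ebe oga; rewrite /odd_nf ztz_gen oga /=; set w := \prod_(i <- ga) _.
have -> : bmul gen_y be (sym2_mk 0 0 w) = sym2_mk 0 0 ((\prod_(i <- be) b i) * w).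
  elim/seq_pair_ind: be ebe => //= [_|i j be IH]; first by rewrite big_nil mul1r.
  rewrite negbK => /IH ->; rewrite /jassoc !big_cons !(sym2_mkM, sym2_mkN, sym2_mkD).
  by congr sym2_mk; field.
elim: al => [|i al IH] /=; first by rewrite big_nil mul1r.
by rewrite IH big_cons sym2_mkM; congr sym2_mk; field.
Qed.

Lemma even_nf_gen al be ga : ga != [::] -> ~~ odd (size ga) ->
  let w := (\prod_(i <- al) a i) * (\prod_(i <- be) b i) * \prod_(i <- ga) c i in
  even_nf gen_y gen_z al be ga = sym2_mk w (if odd (size be) then - w else w) 0.
Proof.
case: ga => //= d g _; rewrite negbK => og; case: ifPn => [|ebe].
  case: be => //= i be ebe; rewrite odd_nf_gen //= !big_cons.
  by rewrite /eterm !(sym2_mkM, sym2_mkN, sym2_mkD); congr sym2_mk; field.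
rewrite odd_nf_gen //= !big_cons.
by rewrite !(sym2_mkM, sym2_mkN, sym2_mkD); congr sym2_mk; field.
Qed.

End GenericPoint.

End Sym2Coordinates.

(** * Linear independence of monomials over an infinite field *)
Section Independence.
Variables (K : fieldType) (K_infinite : infinite_set [set: K]).

Lemma poly_vanishing (P : {poly K}) : (forall x, P.[x] = 0) -> P = 0.
Proof.
move=> P0; apply: contrapT => /eqP nzP.
have [B _ sB] := infinite_set_fset (size P) K_infinite.
have := max_poly_roots nzP (_ : all (root P) B) (fset_uniq B).
rewrite ltnNge sB => E; suff: false by []; apply: E.
by apply/allP => x _; apply/rootP.
Qed.

Lemma prod_count (V : eqType) (v : V) (s : V -> K) (w : seq V) :
  \prod_(x <- w) s x =
  s v ^+ count_mem v w * \prod_(x <- w | x != v) s x.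
Proof.
elim: w => [|x w IH]; first by rewrite !big_nil mul1r.
rewrite !big_cons IH /=; case: eqVneq => [->|_] /=; first by rewrite exprS mulrA.
by rewrite mulrCA.
Qed.

Variables (V : eqType) (F : lmodType K) (n : nat).
Variables (c : 'I_n -> K) (w : 'I_n -> seq V) (h : 'I_n -> F).

Let vanishes (r : seq 'I_n) :=
  forall s : V -> K, \sum_(i <- r) c i * \prod_(x <- w i) s x = 0.

(** If a combination of monomials vanishes everywhere, so does its part of
    degree d in the variable v: seen as a polynomial in v with the other
    variables fixed, all its coefficients are zero. *)
Lemma vanishes_count (v : V) d r :
  vanishes r -> vanishes [seq i <- r | count_mem v (w i) == d].
Proof.
move=> r0 s.
pose P : {poly K} :=
  \sum_(i <- r) (c i * \prod_(x <- w i | x != v) s x) *: 'X^(count_mem v (w i)).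
have P0 : P = 0.
  apply: poly_vanishing => t; rewrite /P horner_sum.
  rewrite -[RHS](r0 (fun x => if x == v then t else s x)).
  apply: eq_bigr => i _; rewrite hornerZ hornerXn (prod_count v) eqxx.
  rewrite -mulrA [in LHS](mulrC (\prod_(x <- _ | _) _)); congr (_ * (_ * _)).
  by apply: eq_bigr => x /negPf ->.
have := congr1 (fun Q : {poly K} => Q`_d * s v ^+ d) P0.
rewrite coef0 mul0r coef_sum mulr_suml big_filter => E; rewrite -[RHS]E {E}.
rewrite [RHS](bigID (fun i => count_mem v (w i) == d)) /= [X in _ + X]big1 ?addr0.
  apply: eq_bigr => i /eqP <-; rewrite coefZ coefXn eqxx mulr1 (prod_count v).
  by rewrite -mulrA [in RHS](mulrC (\prod_(x <- _ | _) _)).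
by move=> i ne; rewrite coefZ coefXn eq_sym (negPf ne) mulr0 mul0r.
Qed.

Hypothesis h_perm : forall i j, perm_eq (w i) (w j) -> h i = h j.

(** Splitting by degree in one variable after the other leaves sums over a
    single monomial; there h is constant and, evaluating at 1, the coefficients
    add up to zero. *)
Lemma vanishing_sum :
  (forall s : V -> K, \sum_(i < n) c i * \prod_(x <- w i) s x = 0) ->
  \sum_(i < n) c i *: h i = 0.
Proof.
suff key (vs : seq V) (r : seq 'I_n) : vanishes r ->
    (forall i j, i \in r -> j \in r -> forall x, x \notin vs ->
       count_mem x (w i) = count_mem x (w j)) ->
    \sum_(i <- r) c i *: h i = 0.
  move=> van; apply: (key (flatten (codom w)) (index_enum _) van) => i j _ _ x.
  move=> /flattenP xw; have cnt0 k : count_mem x (w k) = 0%N.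
    apply/count_memPn/negP => xwk; apply: xw; exists (w k) => //.
    exact: codom_f.
  by rewrite !cnt0.
elim: vs r => [|v vs IH] r van cnt.
  case: r => [|i0 r] in van cnt *; first by rewrite big_nil.
  have -> : \sum_(i <- i0 :: r) c i *: h i = (\sum_(i <- i0 :: r) c i) *: h i0.
    rewrite scaler_suml big_seq [RHS]big_seq; apply: eq_bigr => i ir.
    congr (_ *: _); apply/h_perm/allP => x _; apply/eqP/cnt => //.
    exact: mem_head.
  have := van (fun=> 1); under eq_bigr do rewrite big1 ?mulr1 //.
  by move=> ->; rewrite scale0r.
pose D := (\max_(i < n) count_mem v (w i)).+1.
rewrite (partition_big (fun i => inord (count_mem v (w i)) : 'I_D) predT) //=.
apply: big1 => d _.
have E i : (inord (count_mem v (w i)) == d :> 'I_D) = (count_mem v (w i) == d).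
  rewrite -val_eqE /= inordK // ltnS.
  exact: (leq_bigmax (F := fun i => count_mem v (w i))).
rewrite (eq_bigl _ _ E) -big_filter; apply: IH; first exact: vanishes_count.
move=> i j; rewrite !mem_filter => /andP[/eqP ci ir] /andP[/eqP cj jr] x xvs.
have [->|xv] := eqVneq x v; first by rewrite ci cj.
by apply: cnt; rewrite // inE (negPf xv).
Qed.

End Independence.

(** * Homomorphic images of normal forms *)
Section WordHoms.
Variables (K : fieldType) (A B : jordanType K) (phi : A -> B).
Hypothesis hphi : jordan_hom phi.
Variables y z : nat -> A.

Lemma jhom_ymul r m : phi (ymul y r m) = ymul (phi \o y) r (phi m).
Proof. by elim: r => //= i r <-; rewrite (jhomM hphi). Qed.

Lemma jhom_zmul r m : phi (zmul z r m) = zmul (phi \o z) r (phi m).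
Proof. by elim: r => //= i r <-; rewrite (jhomM hphi). Qed.

Lemma jhom_bmul r m : phi (bmul y r m) = bmul (phi \o y) r (phi m).
Proof.
by elim/seq_pair_ind: r => //= i j r <-; rewrite (jhom_jassoc hphi).
Qed.

Lemma jhom_ytz r : phi (ymul y r jone) = ymul (phi \o y) r jone.
Proof. by rewrite jhom_ymul (jhom1 hphi). Qed.

Lemma jhom_odd_nf al be ga :
  phi (odd_nf y z al be ga) = odd_nf (phi \o y) (phi \o z) al be ga.
Proof. by rewrite /odd_nf jhom_ymul jhom_bmul jhom_zmul (jhom1 hphi). Qed.

Lemma jhom_even_nf al be ga :
  phi (even_nf y z al be ga) = even_nf (phi \o y) (phi \o z) al be ga.
Proof.
case: ga => [|c g] /=; first exact: jhom0.
case: ifP => _; last by rewrite (jhomM hphi) jhom_odd_nf.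
case: be => [|b be]; first exact: jhom0.
by rewrite /eterm (jhomB hphi) !(jhomM hphi) jhom_odd_nf.
Qed.

Lemma jhom_lincomb n (c : 'I_n -> K) (u : 'I_n -> A) :
  phi (\sum_(i < n) c i *: u i) = \sum_(i < n) c i *: phi (u i).
Proof. by rewrite (jhom_sum hphi); apply: eq_bigr => i _; rewrite (jhomZ hphi). Qed.
End WordHoms.

(** * The generated T-ideal and its quotient *)
Definition basis_polys (K : fieldType) : set (JX K) :=
  let y i : JX K := fj_gen K (Yvar i) in
  let z i : JX K := fj_gen K (Zvar i) in
  let x p i : JX K := fj_gen K (xvar p i) in
    [set f | exists p q : bool,
       f = x p 1%N ** (x p 2%N ** x q 3%N) - x p 2%N ** (x p 1%N ** x q 3%N)]
    `|` [set jassoc (y 1%N ** y 2%N) (z 1%N) (z 2%N)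
             - (y 1%N ** jassoc (y 2%N) (z 1%N) (z 2%N)
                + y 2%N ** jassoc (y 1%N) (z 1%N) (z 2%N)
                - 2%:R *: (z 1%N ** jassoc (z 2%N) (y 1%N) (y 2%N)))]
    `|` [set jassoc (y 1%N ** y 2%N) (y 3%N) (z 1%N)
             - (y 1%N ** jassoc (y 2%N) (y 3%N) (z 1%N)
                + y 2%N ** jassoc (y 1%N) (y 3%N) (z 1%N))]
    `|` [set f | exists p q : bool,
           f = jassoc (z 1%N ** z 2%N) (x p 3%N) (x q 4%N)]
    `|` [set f | exists p : bool,
           f = jassoc5 (y 1%N) (y 2%N) (z 1%N) (x p 4%N) (y 3%N)
               - jassoc5 (y 1%N) (y 3%N) (z 1%N) (x p 4%N) (y 2%N)].

Section BasisIdentities.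
Variables (K : fieldType) (A : jordanType K) (gr : bool -> set A).
Hypothesis grA : jordan_grading gr.

Let evE (s : gvar -> A) := (jhomN (fj_eval_hom s), jhomD (fj_eval_hom s),
  jhomZ (fj_eval_hom s), jhomM (fj_eval_hom s), jhom_jassoc (fj_eval_hom s),
  fj_eval_gen s).

Lemma var_deg_xvar p i : var_deg (xvar p i) = p. Proof. by case: p. Qed.

Lemma basis_polys_identities :
  basis_identities gr -> @basis_polys K `<=` graded_identities gr.
Proof.
move=> idA f Sf s grs.
have gx p i : gr p (s (xvar p i)) by rewrite -{1}(var_deg_xvar p i).
have gy i : gr false (s (Yvar i)) := grs (Yvar i).
have gz i : gr true (s (Zvar i)) := grs (Zvar i).
case: Sf => [[[[[p [q ->]]|->]|->]|[p [q ->]]]|[p ->]];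
  rewrite /jassoc5 !(evE s); first 1 last.
- by rewrite (bid_deriv_zz idA) // subrr.
- by rewrite (bid_deriv_yz idA) // subrr.
- exact: (bid_zz_nucleus idA (gz 1%N) (gz 2%N) (gx p 3%N) (gx q 4%N)).
- apply/eqP; rewrite subr_eq0; apply/eqP.
  exact: (bid_swap idA (gy 1%N) (gy 2%N) (gy 3%N) (gz 1%N) (gx p 4%N)).
- apply/eqP; rewrite subr_eq0; apply/eqP.
  exact: (bid_lcomm idA (gx p 1%N) (gx p 2%N) (gx q 3%N)).
Qed.

(** The letters of the basis polynomials are numbered from 1, hence the value 0
    in front of the given ones. *)
Definition assign (ys zs : seq A) (x : gvar) : A :=
  match x with Yvar i => nth 0 (0 :: ys) i | Zvar i => nth 0 (0 :: zs) i end.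

Let all_gr p (r : seq A) : Prop := foldr (fun a P => gr p a /\ P) True r.

Lemma assign_graded ys zs :
  all_gr false ys -> all_gr true zs -> forall x, gr (var_deg x) (assign ys zs x).
Proof.
have nthg p r i : all_gr p r -> gr p (nth 0 (0 :: r) i).
  case: i => [_|i]; first exact: (jgr0 grA).
  elim: r i => [i _|a r IH [|i] [ga gr_r]] /=; last exact: IH.
    by rewrite nth_nil; apply: (jgr0 grA).
  exact: ga.
by move=> gys gzs [i|i]; apply: nthg.
Qed.

Lemma identities_of_basis_polys :
  @basis_polys K `<=` graded_identities gr -> basis_identities gr.
Proof.
move=> idS.
have ev ys zs f : basis_polys f -> all_gr false ys -> all_gr true zs ->
    fj_eval (assign ys zs) f = 0.
  by move=> Sf gys gzs; apply: (idS f Sf); apply: assign_graded.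
split.
- move=> p q a b c ga gb gc; apply/eqP; rewrite -subr_eq0; apply/eqP.
  have := ev
    [:: if p then 0 else a; if p then 0 else b; if q then 0 else c]
    [:: if p then a else 0; if p then b else 0; if q then c else 0] _
    (or_introl (or_introl (or_introl (or_introl
      (ex_intro _ p (ex_intro _ q erefl)))))).
  by rewrite !(evE _); case: p ga gb; case: q gc => /= gc ga gb ->;
    do ?split; rewrite //; apply: (jgr0 grA).
- move=> u v m n gu gv gm gn; apply/eqP; rewrite -subr_eq0; apply/eqP.
  have := ev [:: u; v] [:: m; n] _
    (or_introl (or_introl (or_introl (or_intror erefl)))).
  by rewrite !(evE _) => ->.
- move=> u v w m gu gv gw gm; apply/eqP; rewrite -subr_eq0; apply/eqP.
  have := ev [:: u; v; w] [:: m] _ (or_introl (or_introl (or_intror erefl))).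
  by rewrite !(evE _) => ->.
- move=> p q m n a b gm gn ga gb.
  have := ev [:: 0; 0; if p then 0 else a; if q then 0 else b]
     [:: m; n; if p then a else 0; if q then b else 0] _
     (or_introl (or_intror (ex_intro _ p (ex_intro _ q erefl)))).
  by rewrite !(evE _); case: p ga; case: q gb => /= ga gb ->;
    do ?split; rewrite //; apply: (jgr0 grA).
- move=> p u v w m a gu gv gw gm ga; apply/eqP; rewrite -subr_eq0; apply/eqP.
  have := ev [:: u; v; w; if p then 0 else a] [:: m; 0; 0; if p then a else 0] _
     (or_intror (ex_intro _ p erefl)).
  rewrite /jassoc5 !(evE _); case: p ga => /= ga ->;
    by do ?split; rewrite //; apply: (jgr0 grA).
Qed.

End BasisIdentities.

Lemma graded_Tideal_gen_Tideal (K : fieldType) (S : set (JX K)) :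
  graded_Tideal (graded_Tideal_gen S).
Proof.
split; first split.
- by move=> I [[idI _] _]; apply: (jideal0 idI).
- by move=> a b Ia Ib I HI; apply: (jidealD HI.1.1); [apply: Ia | apply: Ib].
- by move=> k a Ia I HI; apply: (jidealZ HI.1.1); apply: Ia.
- by move=> a b Ia I HI; apply: (jidealM HI.1.1); apply: Ia.
- by move=> phi gphi f If I HI; apply: (HI.1.2 phi gphi); apply: If.
Qed.

Section QuotientByTideal.
Variables (K : fieldType) (I : set (JX K)).
Hypotheses (tI : graded_Tideal I) (SI : @basis_polys K `<=` I).

Local Notation Q := (jquot tI.1).
Local Notation pi := (@jpi K (JX K) I tI.1).

Definition quot_gr (p : bool) : set Q := [set x | exists2 f, JX_gr p f & x = pi f].

Let hpi : jordan_hom pi := jpi_hom tI.1.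

Lemma jpi_eq0 f : pi f = 0 <-> I f.
Proof. by rewrite -(jhom0 hpi) jpi_eq subr0. Qed.

Lemma quot_grading : jordan_grading quot_gr.
Proof.
have grX := JX_grading K; split.
- by move=> p; exists 0; [apply: (jgr0 grX) | rewrite (jhom0 hpi)].
- move=> p _ _ [f gf ->] [g gg ->]; exists (f + g); first exact: (jgrD grX).
  by rewrite (jhomD hpi).
- move=> p k _ [f gf ->]; exists (k *: f); first exact: (jgrZ grX).
  by rewrite (jhomZ hpi).
- by exists jone; [apply: (jgr1 grX) | rewrite (jhom1 hpi)].
- move=> p q _ _ [f gf ->] [g gg ->]; exists (f ** g); first exact: (jgrM grX).
  by rewrite (jhomM hpi).
Qed.

(** A graded assignment with values in J(X)/I lifts to a graded endomorphism of
    J(X), which maps I to itself. *)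
Lemma quot_identities : I `<=` graded_identities quot_gr.
Proof.
move=> f If s grs.
have /choice[t tP] x : exists g, JX_gr (var_deg x) g /\ s x = pi g.
  by have [g gg ->] := grs x; exists g.
have -> : s = pi \o t by apply: funext => x; rewrite (tP x).2.
rewrite -fj_eval_comp //; apply/jpi_eq0/(tI.2 _ _ _ If).
by apply: fj_eval_endo => x; apply: (tP x).1.
Qed.

Lemma quot_basis_identities : basis_identities quot_gr.
Proof.
apply: (identities_of_basis_polys quot_grading) => f /SI; exact: quot_identities.
Qed.

End QuotientByTideal.
Arguments quot_gr [K I] tI p.

(** * Every graded identity lies in the T-ideal *)
Definition nf_index : Type := (seq nat * seq nat * seq nat)%type.

(** One word in three disjoint alphabets, so that the independence of monomials
    applies to normal forms. *)
Definition nf_word (t : nf_index) : seq (nat + nat + nat) :=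
  let: (al, be, ga) := t in
  [seq inl (inl i) | i <- al] ++ [seq inl (inr i) | i <- be] ++
  [seq inr i | i <- ga].

Lemma nf_word_perm al be ga al' be' ga' :
  perm_eq (nf_word (al, be, ga)) (nf_word (al', be', ga')) ->
  [/\ perm_eq al al', perm_eq be be' & perm_eq ga ga'].
Proof.
pose fA (l : nat + nat + nat) := if l is inl (inl i) then Some i else None.
pose fB (l : nat + nat + nat) := if l is inl (inr i) then Some i else None.
pose fC (l : nat + nat + nat) := if l is inr i then Some i else None.
have EA a b c : pmap fA (nf_word (a, b, c)) = a.
  elim: a => [|i a /= ->] //=; elim: b => [|i b /=] //=.
  by elim: c.
have EB a b c : pmap fB (nf_word (a, b, c)) = b.
  elim: a => [|i a /= ->] //=; elim: b => [|i b /= ->] //=.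
  by elim: c.
have EC a b c : pmap fC (nf_word (a, b, c)) = c.
  elim: a => [|i a /= ->] //=; elim: b => [|i b /= ->] //=.
  by elim: c => //= i c ->.
move=> E; split.
- by have := perm_pmap fA E; rewrite !EA.
- by have := perm_pmap fB E; rewrite !EB.
- by have := perm_pmap fC E; rewrite !EC.
Qed.

Lemma nf_word_prod (K : fieldType) (s : nat + nat + nat -> K) al be ga :
  \prod_(x <- nf_word (al, be, ga)) s x =
  (\prod_(i <- al) s (inl (inl i))) * (\prod_(i <- be) s (inl (inr i))) *
  \prod_(i <- ga) s (inr i).
Proof. by rewrite /nf_word !big_cat !big_map /= mulrA. Qed.

Lemma sum_sym2_mk (K : fieldType) (K2 : 2%N \notin [pchar K]) n (p q r : 'I_n -> K) :
  \sum_(i < n) sym2_mk K2 (p i) (q i) (r i) =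
  sym2_mk K2 (\sum_(i < n) p i) (\sum_(i < n) q i) (\sum_(i < n) r i).
Proof.
elim: n p q r => [|n IH] p q r; first by rewrite !big_ord0 sym2_mk0.
by rewrite !big_ord_recl IH sym2_mkD.
Qed.

Section Completeness.
Variables (K : fieldType) (K_infinite : infinite_set [set: K]).
Variable K2 : 2%N \notin [pchar K].
Local Notation T2 := (graded_identities (sym2_gr (K2 := K2))).

(** The heart of the theorem: f and its normal form g in J(X) differ by an
    element of I, hence g vanishes at the generic point, and independence of
    monomials makes the image of g in J(X)/I zero. *)
Lemma identities_sub_Tideal (I : set (JX K)) :
  graded_Tideal I -> @basis_polys K `<=` I -> I `<=` T2 -> T2 `<=` I.
Proof.
move=> tI SI IT2 f T2f; apply/(jpi_eq0 tI).
have hpi := jpi_hom tI.1; set pi := jpi _ in hpi *.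
have grQ := quot_grading tI; have idQ := quot_basis_identities tI SI.
pose gen (x : gvar) := fj_gen K x.
have gr_gen x : quot_gr tI (var_deg x) (pi (gen x)).
  by exists (gen x) => //; apply: JX_gr_gen.
pose yX i := gen (Yvar i); pose zX i := gen (Zvar i).
pose yQ := pi \o yX; pose zQ := pi \o zX.
have gyQ i : quot_gr tI false (yQ i) := gr_gen (Yvar i).
have gzQ i : quot_gr tI true (zQ i) := gr_gen (Zvar i).
have Ef : pi f = fj_eval (pi \o gen) f by apply: (fj_eval_unique hpi).
have [u [v [Wu Wv]]] := normal_form_span grQ idQ f gr_gen.
rewrite -Ef => {}Ef.
have [u1 [u2 [Wu1 Wu2 Eu]]] := span_of_setU Wu.
pose D1 (t : nf_index) := ~~ odd (size t.1.2) /\ odd (size t.2).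
pose D0 (t : nf_index) := t.2 != [::] /\ ~~ odd (size t.2).
pose N1 (A : jordanType K) (y z : nat -> A) (t : nf_index) :=
  odd_nf y z t.1.1 t.1.2 t.2.
pose N0 (A : jordanType K) (y z : nat -> A) (t : nf_index) :=
  even_nf y z t.1.1 t.1.2 t.2.
have [|n1 [c1 [t1 [Dt1 Ev]]]] := span_of_param (D := D1) (N := N1 _ yQ zQ) Wv.
  by move=> _ [al [be [ga [ebe oga ->]]]]; exists (al, be, ga).
have [|n0 [c0 [t0 [Dt0 Eu1]]]] := span_of_param (D := D0) (N := N0 _ yQ zQ) Wu1.
  by move=> _ [al [be [ga [ga0 ega ->]]]]; exists (al, be, ga).
have [|n2 [c2 [t2 [_ Eu2]]]] :=
    span_of_param (D := fun=> True) (N := fun al => ymul yQ al jone) Wu2.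
  by move=> _ [al ->]; exists al.
(* The normal form of f, lifted to J(X). *)
pose g := \sum_(i < n1) c1 i *: N1 _ yX zX (t1 i) +
  (\sum_(i < n0) c0 i *: N0 _ yX zX (t0 i) +
   \sum_(i < n2) c2 i *: ymul yX (t2 i) jone).
have Ifg : I (f - g).
  apply/(jpi_eq0 tI); rewrite -/pi (jhomB hpi) Ef Eu Ev Eu1 Eu2 /g !(jhomD hpi).
  rewrite !(jhom_lincomb hpi).
  under [X in _ - (X + _)]eq_bigr do rewrite (jhom_odd_nf hpi).
  under [X in _ - (_ + (X + _))]eq_bigr do rewrite (jhom_even_nf hpi).
  under [X in _ - (_ + (_ + X))]eq_bigr do rewrite (jhom_ytz hpi).
  by apply/eqP; rewrite subr_eq0 addrC.
pose val (a b c : nat -> K) (t : nf_index) :=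
  (\prod_(i <- t.1.1) a i) * (\prod_(i <- t.1.2) b i) * \prod_(i <- t.2) c i.
(* The off-diagonal and the upper left entry of g at the generic point. *)
have ev a b c :
    \sum_(i < n1) c1 i * val a b c (t1 i) = 0 /\
    \sum_(i < n0) c0 i * val a b c (t0 i) +
    \sum_(i < n2) c2 i * \prod_(j <- t2 i) (a j + b j) = 0.
  pose s (x : gvar) :=
    match x with Yvar i => gen_y K2 a b i | Zvar i => gen_z K2 c i end.
  have grs x : sym2_gr (K2 := K2) (var_deg x) (s x).
    case: x => i; last by apply/sym2_gr1E; eexists.
    by apply/sym2_gr0E; eexists; eexists.
  have hs := fj_eval_hom s.
  have := T2f s grs; rewrite -(subrK g f) (jhomD hs) (IT2 _ Ifg s grs) add0r.
  rewrite !(jhomD hs) !(jhom_lincomb hs).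
  have Ey : fj_eval s \o yX = gen_y K2 a b.
    by apply: funext => i /=; rewrite fj_eval_gen.
  have Ez : fj_eval s \o zX = gen_z K2 c.
    by apply: funext => i /=; rewrite fj_eval_gen.
  under [X in X + _]eq_bigr => i _.
    rewrite (jhom_odd_nf hs) Ey Ez odd_nf_gen ?(Dt1 i).1 ?(Dt1 i).2 //.
    rewrite sym2_mkZ !mulr0.
    over.
  under [X in _ + (X + _)]eq_bigr => i _.
    rewrite (jhom_even_nf hs) Ey Ez even_nf_gen ?(Dt0 i).1 ?(Dt0 i).2 //.
    rewrite sym2_mkZ mulr0.
    over.
  under [X in _ + (_ + X)]eq_bigr => i _.
    rewrite (jhom_ytz hs) Ey ytz_gen sym2_mkZ mulr0.
    over.
  rewrite !sum_sym2_mk !sym2_mkD (sym2_mk0 K2) !sumr_const !mul0rn !addr0 !add0r.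
  move=> /(congr1 (@sym2_val _ _))/matrixP E.
  by have := E 0 0; have := E 0 1; rewrite !mxE.
have odd0 : \sum_(i < n1) c1 i *: N1 _ yQ zQ (t1 i) = 0.
  apply: (vanishing_sum K_infinite (w := fun i => nf_word (t1 i))) => [i j|s].
    case: (t1 i) (Dt1 i) => [[al be] ga] [/= eb og]; case: (t1 j) => [[al' be'] ga'].
    by move=> /nf_word_perm[pa pb pc]; apply: (odd_nf_perm grQ idQ).
  rewrite -[RHS](ev (fun i => s (inl (inl i))) (fun i => s (inl (inr i)))
    (fun i => s (inr i))).1.
  by apply: eq_bigr => i _; case: (t1 i) => [[al be] ga]; rewrite nf_word_prod.
(* c = 0 kills each even normal form, whose third word is nonempty, and b = 0
   turns the words in the y's into monomials in a. *)
have c2_vanish (a : nat -> K) : \sum_(i < n2) c2 i * \prod_(j <- t2 i) a j = 0.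
  have := (ev a (fun=> 0) (fun=> 0)).2; rewrite big1 ?add0r.
    by under eq_bigr do under eq_bigr do rewrite addr0.
  move=> i _; have [] := Dt0 i; case: (t0 i) => [[al be] [|d ga]] //= _ _.
  by rewrite /val /= big_cons mul0r !mulr0.
have y0 : \sum_(i < n2) c2 i *: ymul yQ (t2 i) jone = 0.
  apply: (vanishing_sum K_infinite (w := t2)) => // i j.
  exact: (ytz_perm grQ idQ).
(* The words in the y's contribute zero to ev, by c2_vanish at a + b. *)
have even0 : \sum_(i < n0) c0 i *: N0 _ yQ zQ (t0 i) = 0.
  apply: (vanishing_sum K_infinite (w := fun i => nf_word (t0 i))) => [i j|s].
    case: (t0 i) (Dt0 i) => [[al be] ga] [/= g0 eg]; case: (t0 j) => [[al' be'] ga'].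
    by move=> /nf_word_perm[pa pb pc]; apply: (even_nf_perm grQ idQ).
  have := (ev (fun i => s (inl (inl i))) (fun i => s (inl (inr i)))
    (fun i => s (inr i))).2.
  rewrite c2_vanish addr0 => E; rewrite -[RHS]E.
  by apply: eq_bigr => i _; case: (t0 i) => [[al be] ga]; rewrite nf_word_prod.
by rewrite Ef Eu Ev Eu1 Eu2 odd0 y0 even0 !addr0.
Qed.

End Completeness.

Theorem sym2_identities_generated (K : fieldType)
    (K_infinite : infinite_set [set: K]) (K2 : 2%N \notin [pchar K]) :
  graded_identities (sym2_gr (K2 := K2)) =
  graded_Tideal_gen (@basis_polys K).
Proof.
have tT := graded_identities_Tideal (sym2_grading K2).
have ST := basis_polys_identities (sym2_basis_identities K2).
have GT := graded_Tideal_gen_Tideal (@basis_polys K).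
have GsubT : graded_Tideal_gen (@basis_polys K) `<=`
    graded_identities (sym2_gr (K2 := K2)) by move=> f; apply.
apply/seteqP; split=> //.
by apply: identities_sub_Tideal => // f Sf I [_]; apply.
Qed.

Theorem theorem16 (K : fieldType)
    (K_infinite : infinite_set [set: K]) (K2 : 2%N \notin [pchar K]) :
  let y i : JX K := fj_gen K (Yvar i) in
  let z i : JX K := fj_gen K (Zvar i) in
  let x p i : JX K := fj_gen K (xvar p i) in
  graded_identities (sym2_gr (K2 := K2)) =
  graded_Tideal_gen (
    [set f | exists p q : bool,
       f = x p 1%N ** (x p 2%N ** x q 3%N) - x p 2%N ** (x p 1%N ** x q 3%N)]
    `|` [set jassoc (y 1%N ** y 2%N) (z 1%N) (z 2%N)
             - (y 1%N ** jassoc (y 2%N) (z 1%N) (z 2%N)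
                + y 2%N ** jassoc (y 1%N) (z 1%N) (z 2%N)
                - 2%:R *: (z 1%N ** jassoc (z 2%N) (y 1%N) (y 2%N)))]
    `|` [set jassoc (y 1%N ** y 2%N) (y 3%N) (z 1%N)
             - (y 1%N ** jassoc (y 2%N) (y 3%N) (z 1%N)
                + y 2%N ** jassoc (y 1%N) (y 3%N) (z 1%N))]
    `|` [set f | exists p q : bool,
           f = jassoc (z 1%N ** z 2%N) (x p 3%N) (x q 4%N)]
    `|` [set f | exists p : bool,
           f = jassoc5 (y 1%N) (y 2%N) (z 1%N) (x p 4%N) (y 3%N)
               - jassoc5 (y 1%N) (y 3%N) (z 1%N) (x p 4%N) (y 2%N)]).
Proof. exact: sym2_identities_generated. Qed.
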